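(* Let $c, d$ be complex numbers with $d\neq 0$. Let $a(z)$ be an entire function in $\mathbf{C}$ and let $P(z_1,z_2)$ be an entire function in $\mathbf{C}^2$ divisible by $(z_1-c)(z_2-d)$ in the ring of entire functions in $\mathbf{C}^2$. Then any entire solution $f$ in $\mathbf{C}$ of the differential equation $$f'(z)+a(z)\,P(f(z),f'(z))=0\qquad (z\in\mathbf{C})$$ must be constant.
   Context: An entire function in $\mathbf{C}^n$ is a function $\mathbf{C}^n\to\mathbf{C}$ holomorphic on all of $\mathbf{C}^n$. Divisibility of $P$ by $(z_1-c)(z_2-d)$ in the ring of entire functions means that $P(z_1,z_2)=(z_1-c)(z_2-d)g(z_1,z_2)$ for some entire function $g$ in $\mathbf{C}^2$. *)

(* Defs.v *)
(* Stdlib reals with Coquelicot's complex numbers. *)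
From Stdlib Require Import Reals.
From Coquelicot Require Import Coquelicot.

(* The scalar field in [ex_derive] is [C_AbsRing], so this is complex
   differentiability, not differentiability over the reals. *)
Definition entire (f : C -> C) : Prop :=
  forall z : C, @ex_derive C_AbsRing C_NormedModule f z.

(* Holomorphy in two variables: at each point a C-linear (Frechet)
   differential exists, [C * C] being normed over [C_AbsRing] by the Euclidean
   product norm. *)
Definition entire2 (F : C * C -> C) : Prop :=
  forall p : C * C,
    @ex_filterdiff C_AbsRing
      (prod_NormedModule C_AbsRing C_NormedModule C_NormedModule)
      C_NormedModule F (locally p).

Definition entire2_divides (Q P : C * C -> C) : Prop :=
  exists g : C * C -> C,
    entire2 g /\ forall p : C * C, P p = Cmult (Q p) (g p).

(* Main.v *)
Require Import Defs.
From Stdlib Require Import Reals ZArith Lra Lia Psatz ClassicalEpsilon FunctionalExtensionality.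
From Coquelicot Require Import Coquelicot.

(** The idea. Put [F = f - c]. Divisibility turns the equation into [F' = q F],
    where [q = - a (f' - d) g (f, f')] is entire, so [F = K exp h] for a constant
    [K] and a primitive [h] of [q] ([log_derivative]). If [K = 0] we are done.
    Otherwise [f] omits [c]. Moreover [f'] omits [d], since at a point where
    [f' = d] the equation gives [f' = 0]. So everything rests on a theorem of
    Picard type ([omitted_values]): an entire function that omits [c], and whose
    derivative omits some [d <> 0], is constant.

    To prove it, write [f' - d = w0 exp k] as well. Differentiating
    [K h' exp h = d + w0 exp k] and eliminating [exp k] gives
      [K exp h * D = d k']  with  [D = h' k' - h'' - h' ^ 2].
    Here [D] vanishes exactly where [f''] does. If [f''] is identically zero, [f]
    is affine, and an affine function omits a value only if it is constant.
    Otherwise we translate so that [D 0 <> 0]. Now [D] and [k'] are built from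
    derivatives of [h] and [k], so their logarithms are of the order of the
    logarithm of the size of [h], while [D] is as small as [exp (- Re h)] where
    [Re h] is positive. Since the mean of [log |D|] on a circle is at least
    [log |D 0|], the mean of the positive part of [Re h] is [O (log (size of h))];
    but it controls the size of [h] itself on a slightly smaller disc
    ([coefficient_improvement]). Such a self-improving bound forces the Taylor
    coefficients of [h] of positive index to vanish ([growth_lemma],
    [bounded_coefficients_vanish]).

    This is Nevanlinna's method, with integral means on circles replaced by means
    over the vertices of regular polygons, that is, over roots of unity. For these
    means, coefficient formulas are exact on polynomials ([coef_mean]), and Jensen's
    inequality is the maximum principle applied to the product of the rotations of
    [D] ([rotation_product]).

    The function theory comes from Cauchy's formula. It follows from Goursat's
    bisection argument applied to the homotopy that shrinks a circle to a point
    ([goursat], [cauchy]); expanding its kernel gives Taylor's expansion on every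
    disc ([holomorphic_expands]), and with it derivatives, primitives and entire
    logarithms. *)

Open Scope C_scope.

(** * Complex derivatives *)

(** [C] carries two uniform structures with the same topology: the product one
    and the one of its modulus. The latter makes products continuous by the
    general theory of normed rings, so continuity is stated with it. *)
Notation CU := (AbsRing_UniformSpace C_AbsRing).

Definition C_continuous {U : UniformSpace} (f : U -> C) (x : U) : Prop :=
  @continuous U CU f x.

(** Caratheodory's form of differentiability: the difference quotient extends
    continuously to [z]. The product, chain and inverse rules then reduce to
    algebra and to the continuity of the factor [phi]. *)
Definition has_deriv (f : C -> C) (z l : C) : Prop :=
  exists phi : C -> C, C_continuous (U := CU) phi z /\ phi z = l /\
    forall w, f w - f z = phi w * (w - z).

Definition holomorphic (f : C -> C) : Prop := forall z, exists l, has_deriv f z l.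

Lemma C_continuous_const {U : UniformSpace} (c : C) (x : U) : C_continuous (fun _ => c) x.
Proof. exact (continuous_const (V := CU) c x). Qed.

Lemma C_continuous_id (z : C) : C_continuous (U := CU) (fun w => w) z.
Proof. exact (continuous_id (U := CU) z). Qed.

Lemma C_continuous_plus {U : UniformSpace} (f g : U -> C) x :
  C_continuous f x -> C_continuous g x -> C_continuous (fun y => f y + g y) x.
Proof.
exact (continuous_plus (V := AbsRing_NormedModule C_AbsRing) f g x).
Qed.

Lemma C_continuous_mult {U : UniformSpace} (f g : U -> C) x :
  C_continuous f x -> C_continuous g x -> C_continuous (fun y => f y * g y) x.
Proof. exact (continuous_mult (K := C_AbsRing) f g x). Qed.

Lemma C_continuous_opp {U : UniformSpace} (f : U -> C) x :
  C_continuous f x -> C_continuous (fun y => - f y) x.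
Proof.
exact (continuous_opp (V := AbsRing_NormedModule C_AbsRing) f x).
Qed.

Lemma C_continuous_minus {U : UniformSpace} (f g : U -> C) x :
  C_continuous f x -> C_continuous g x -> C_continuous (fun y => f y - g y) x.
Proof. intros; apply C_continuous_plus; [|apply C_continuous_opp]; assumption. Qed.

Lemma C_continuous_comp {U : UniformSpace} (f : U -> C) (g : C -> C) x :
  C_continuous f x -> C_continuous (U := CU) g (f x) -> C_continuous (fun y => g (f y)) x.
Proof. exact (continuous_comp (V := CU) (W := CU) f g x). Qed.

Lemma C_continuous_eps (f : C -> C) z :
  C_continuous (U := CU) f z <->
  forall eps : R, (0 < eps)%R -> exists del : R, (0 < del)%R /\
    forall w, (Cmod (w - z) < del)%R -> (Cmod (f w - f z) < eps)%R.
Proof.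
unfold C_continuous. split.
- intros H eps He.
  destruct (proj1 (filterlim_locally (F := locally (T := CU) z) (U := CU) f (f z)) H
              (mkposreal eps He)) as [d Hd].
  exists d; split; [apply cond_pos|]. intros w Hw. exact (Hd w Hw).
- intros H. apply filterlim_locally. intros [eps He].
  destruct (H eps He) as [d [Hd H']]. exists (mkposreal d Hd). intros w Hw.
  exact (H' w Hw).
Qed.

Lemma C_continuous_real_eps (f : R -> C) z :
  (forall eps : R, (0 < eps)%R -> exists del : R, (0 < del)%R /\
    forall w : R, (Rabs (w - z) < del)%R -> (Cmod (f w - f z) < eps)%R) ->
  C_continuous f z.
Proof.
intros H. apply filterlim_locally. intros [eps He].
destruct (H eps He) as [d [Hd H']]. exists (mkposreal d Hd). intros w Hw.
exact (H' w Hw).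
Qed.

Lemma C_continuous_inv {U : UniformSpace} (f : U -> C) x :
  C_continuous f x -> f x <> 0 -> C_continuous (fun y => / f y) x.
Proof.
intros Hf Hx. apply (C_continuous_comp f Cinv); [exact Hf|].
generalize (f x) Hx; clear; intros z Hz.
apply C_continuous_eps; intros eps He.
assert (Hm : (0 < Cmod z)%R) by (apply Cmod_gt_0; exact Hz).
exists (Rmin (Cmod z / 2) (eps * Cmod z * Cmod z / 2)).
split.
{ apply Rmin_pos; [lra|]. apply Rdiv_lt_0_compat; [|lra]. repeat apply Rmult_lt_0_compat; lra. }
intros w Hw.
assert (Hw1 : (Cmod (w - z) < Cmod z / 2)%R) by (eapply Rlt_le_trans; [exact Hw|apply Rmin_l]).
assert (Hw2 : (Cmod (w - z) < eps * Cmod z * Cmod z / 2)%R) by (eapply Rlt_le_trans;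
    [exact Hw|apply Rmin_r]).
assert (Hwm : (Cmod z / 2 < Cmod w)%R).
{ pose proof (Cmod_triangle w (- (w - z))) as T.
  replace (w + - (w - z)) with z in T by ring. rewrite Cmod_opp in T. lra. }
assert (Hw0 : w <> 0) by (apply Cmod_gt_0; lra).
replace (/ w - / z) with (- (w - z) / (w * z)) by (field; auto).
rewrite Cmod_div by (apply Cmult_neq_0; auto).
rewrite Cmod_opp, Cmod_mult.
apply Rmult_lt_reg_r with (Cmod w * Cmod z)%R; [apply Rmult_lt_0_compat; lra|].
unfold Rdiv; rewrite Rmult_assoc, Rinv_l by (apply Rgt_not_eq; apply Rmult_lt_0_compat; lra).
rewrite Rmult_1_r. eapply Rlt_le_trans; [exact Hw2|].
replace (eps * Cmod z * Cmod z / 2)%R with (eps * Cmod z * (Cmod z / 2))%R by field.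
replace (eps * (Cmod w * Cmod z))%R with (eps * Cmod z * Cmod w)%R by ring.
apply Rmult_le_compat_l; [apply Rmult_le_pos; lra|lra].
Qed.

Lemma C_continuous_RtoC (f : R -> R) x : continuous f x -> C_continuous (fun y => RtoC (f y)) x.
Proof.
intros H. apply C_continuous_real_eps. intros eps He.
destruct (proj1 (filterlim_locally (U := R_UniformSpace) f (f x)) H (mkposreal eps He)) as [d Hd].
exists d; split; [apply cond_pos|]. intros w Hw.
rewrite <- RtoC_minus, Cmod_R. exact (Hd w Hw).
Qed.

Lemma has_deriv_C_continuous f z l : has_deriv f z l -> C_continuous (U := CU) f z.
Proof.
intros [phi [H1 [H2 H3]]].
apply (continuous_ext (T := CU) (U := CU) (fun w => f z + phi w * (w - z))).
- intros w. change (@eq C (f z + phi w * (w - z)) (f w)). rewrite <- H3. ring.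
- apply C_continuous_plus; [apply C_continuous_const|]. apply C_continuous_mult; [exact H1|].
  apply C_continuous_minus; [apply C_continuous_id|apply C_continuous_const].
Qed.

Lemma has_deriv_const c z : has_deriv (fun _ => c) z 0.
Proof. exists (fun _ => 0). repeat split; [apply (C_continuous_const (U := CU))|]. intros; ring. Qed.

Lemma has_deriv_id z : has_deriv (fun w => w) z 1.
Proof. exists (fun _ => 1). repeat split; [apply (C_continuous_const (U := CU))|]. intros; ring. Qed.

Lemma has_deriv_plus f g z l m :
  has_deriv f z l -> has_deriv g z m -> has_deriv (fun w => f w + g w) z (l + m).
Proof.
intros [p [P1 [P2 P3]]] [q [Q1 [Q2 Q3]]].
exists (fun w => p w + q w). split; [apply (C_continuous_plus (U := CU)); auto|]. split; [congruence|].
intros w. replace (f w + g w - (f z + g z)) with ((f w - f z) + (g w - g z)) by ring.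
rewrite P3, Q3. ring.
Qed.

Lemma has_deriv_mult f g z l m :
  has_deriv f z l -> has_deriv g z m -> has_deriv (fun w => f w * g w) z (l * g z + f z * m).
Proof.
intros Hf Hg. pose proof (has_deriv_C_continuous _ _ _ Hg) as Cg.
destruct Hf as [p [P1 [P2 P3]]]; destruct Hg as [q [Q1 [Q2 Q3]]].
exists (fun w => p w * g w + f z * q w).
split. { apply (C_continuous_plus (U := CU)); apply (C_continuous_mult (U := CU)); auto.
    apply (C_continuous_const (U := CU)). }
split; [congruence|].
intros w. replace (f w * g w - f z * g z) with ((f w - f z) * g w + f z * (g w - g z)) by ring.
rewrite P3, Q3. ring.
Qed.

Lemma has_deriv_scal c f z l : has_deriv f z l -> has_deriv (fun w => c * f w) z (c * l).
Proof.
intros H. pose proof (has_deriv_mult _ _ _ _ _ (has_deriv_const c z) H) as H'. simpl in H'.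
replace (c * l) with (0 * f z + c * l) by ring. exact H'.
Qed.

Lemma has_deriv_opp f z l : has_deriv f z l -> has_deriv (fun w => - f w) z (- l).
Proof.
intros [p [P1 [P2 P3]]]. exists (fun w => - p w). split; [apply (C_continuous_opp (U := CU)); auto|].
split; [congruence|]. intros w. replace (- f w - - f z) with (- (f w - f z)) by ring.
rewrite P3; ring.
Qed.

Lemma has_deriv_comp f g z l m :
  has_deriv f z l -> has_deriv g (f z) m -> has_deriv (fun w => g (f w)) z (m * l).
Proof.
intros Hf [q [Q1 [Q2 Q3]]]. pose proof (has_deriv_C_continuous _ _ _ Hf) as Cf.
destruct Hf as [p [P1 [P2 P3]]].
exists (fun w => q (f w) * p w). split. { apply (C_continuous_mult (U := CU)); auto.
    apply (C_continuous_comp (U := CU) f q); auto. }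
split; [congruence|]. intros w. rewrite Q3, P3. ring.
Qed.

(** The function may not vanish anywhere, and not only at [z], because the
    factorization of [/ f] is required at every point. *)
Lemma has_deriv_inv f z l :
  has_deriv f z l -> (forall w, f w <> 0) -> has_deriv (fun w => / f w) z (- l / (f z * f z)).
Proof.
intros Hf H0. pose proof (has_deriv_C_continuous _ _ _ Hf) as Cf. destruct Hf as [p [P1 [P2 P3]]].
exists (fun w => - p w * / (f w * f z)). split.
{ apply (C_continuous_mult (U := CU)); [apply (C_continuous_opp (U := CU)); exact P1|].
    apply (C_continuous_inv (U := CU)).
  - apply (C_continuous_mult (U := CU)); [exact Cf|apply (C_continuous_const (U := CU))].
  - apply Cmult_neq_0; auto. }
split; [rewrite P2; reflexivity|].
intros w. replace (- p w * / (f w * f z) * (w - z)) with (- (p w * (w - z)) * / (f w * f z)) by ring.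
rewrite <- P3. field. auto.
Qed.

Lemma has_deriv_ext f g z l : (forall w, f w = g w) -> has_deriv f z l -> has_deriv g z l.
Proof. intros H [p [P1 [P2 P3]]]. exists p. repeat split; auto. intros w. rewrite <- !H. auto. Qed.

Lemma has_deriv_uniq f z l m : has_deriv f z l -> has_deriv f z m -> l = m.
Proof.
intros [p [P1 [P2 P3]]] [q [Q1 [Q2 Q3]]].
apply Ceq_minus. apply Cmod_eq_0. apply Rle_antisym; [|apply Cmod_ge_0].
apply le_epsilon. intros eps He. rewrite Rplus_0_l.
pose proof (C_continuous_minus (U := CU) p q z P1 Q1) as H. rewrite C_continuous_eps in H.
destruct (H eps He) as [d [Hd H']].
specialize (H' (z + RtoC (d / 2))).
replace (z + RtoC (d/2) - z) with (RtoC (d/2)) in H' by ring.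
rewrite Cmod_R, Rabs_pos_eq in H' by lra.
specialize (H' ltac:(lra)).
assert (E : p (z + RtoC (d/2)) = q (z + RtoC (d/2))).
{ pose proof (P3 (z + RtoC (d/2))) as A. rewrite Q3 in A.
  replace (z + RtoC (d/2) - z) with (RtoC (d/2)) in A by ring.
  assert (N : RtoC (d/2) <> 0) by (intros B; apply RtoC_inj in B; lra).
  apply (f_equal (fun x => x / RtoC (d/2))) in A.
  transitivity (p (z + RtoC (d/2)) * RtoC (d/2) / RtoC (d/2)); [field; auto|].
  rewrite <- A. field; auto. }
rewrite E, P2, Q2 in H'. left.
replace (Cmod (l - m)) with (Cmod (q (z + RtoC (d / 2)) - q (z + RtoC (d / 2)) - (l - m))); auto.
rewrite <- Cmod_opp. f_equal. ring.
Qed.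

Lemma has_deriv_of_eps f z l :
  (forall eps : R, (0 < eps)%R -> exists del : R, (0 < del)%R /\
    forall w, (Cmod (w - z) < del)%R ->
      (Cmod (f w - f z - l * (w - z)) <= eps * Cmod (w - z))%R) ->
  has_deriv f z l.
Proof.
intros H.
exists (fun w => if Ceq_dec w z then l else (f w - f z) / (w - z)).
split; [|split].
- apply C_continuous_eps. intros eps He. destruct (H (eps / 2)%R ltac:(lra)) as [d [Hd H']].
  exists d; split; [exact Hd|]. intros w Hw.
  destruct (Ceq_dec z z) as [_|n]; [|now destruct n].
  destruct (Ceq_dec w z) as [E|n].
  + rewrite (proj1 (Ceq_minus l l) eq_refl), Cmod_0. exact He.
  + assert (n' : w - z <> 0) by (apply Cminus_eq_contra; auto).
    replace ((f w - f z) / (w - z) - l) with ((f w - f z - l * (w - z)) / (w - z)) by (field; auto).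
    rewrite Cmod_div by auto. assert (P : (0 < Cmod (w - z))%R) by (apply Cmod_gt_0; auto).
    apply Rle_lt_trans with (eps / 2)%R; [|lra].
    apply Rmult_le_reg_r with (Cmod (w - z)); [auto|].
    unfold Rdiv at 1. rewrite Rmult_assoc, Rinv_l, Rmult_1_r by lra. apply H'; auto.
- destruct (Ceq_dec z z) as [_|n]; [reflexivity|now destruct n].
- intros w. destruct (Ceq_dec w z) as [E|n]; [rewrite E; ring|].
  field. apply Cminus_eq_contra; auto.
Qed.

Lemma has_deriv_eps f z l : has_deriv f z l ->
  (forall eps : R, (0 < eps)%R -> exists del : R, (0 < del)%R /\
    forall w, (Cmod (w - z) < del)%R ->
      (Cmod (f w - f z - l * (w - z)) <= eps * Cmod (w - z))%R).
Proof.
intros [p [P1 [P2 P3]]] eps He. rewrite C_continuous_eps in P1.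
destruct (P1 eps He) as [d [Hd H]]. exists d; split; [exact Hd|].
intros w Hw. rewrite P3. replace (p w * (w - z) - l * (w - z)) with ((p w - l) * (w - z)) by ring.
rewrite Cmod_mult. apply Rmult_le_compat_r; [apply Cmod_ge_0|]. rewrite <- P2. left; auto.
Qed.

Lemma is_derive_has_deriv (f : C -> C) (z l : C) :
  @is_derive C_AbsRing C_NormedModule f z l -> has_deriv f z l.
Proof.
intros [_ H]. apply has_deriv_of_eps. intros eps He.
specialize (H z (fun P HP => HP) (mkposreal eps He)).
destruct H as [d Hd]. exists d; split; [apply cond_pos|].
intros w Hw. specialize (Hd w Hw). 

replace (l * (w - z)) with ((w - z) * l) by ring. exact Hd.
Qed.

(** * Integrals of complex functions of a real variable *)

Definition C_integral (u : R -> C) (a b : R) : C := @RInt C_R_CompleteNormedModule u a b.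

Definition continuous_path (u : R -> C) : Prop := forall x, C_continuous u x.

Lemma continuous_path_const c : continuous_path (fun _ => c).
Proof. intros x; apply C_continuous_const. Qed.
Lemma continuous_path_plus u v : continuous_path u -> continuous_path v -> continuous_path (fun x
    => u x + v x).
Proof. intros H K x; apply C_continuous_plus; auto. Qed.
Lemma continuous_path_minus u v : continuous_path u -> continuous_path v -> continuous_path (fun
    x => u x - v x).
Proof. intros H K x; apply C_continuous_minus; auto. Qed.
Lemma continuous_path_mult u v : continuous_path u -> continuous_path v -> continuous_path (fun x
    => u x * v x).
Proof. intros H K x; apply C_continuous_mult; auto. Qed.

Lemma C_integral_correct u a b : continuous_path u ->
  @is_RInt C_R_CompleteNormedModule u a b (C_integral u a b).
Proof.
intros H. apply RInt_correct. apply ex_RInt_continuous. intros z _.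
specialize (H z). intros P HP. apply H. apply locally_C. exact HP.
Qed.

Lemma C_integral_unique u a b l :
  @is_RInt C_R_CompleteNormedModule u a b l -> C_integral u a b = l.
Proof. exact (is_RInt_unique (V := C_R_CompleteNormedModule) u a b l). Qed.

Lemma C_integral_ext u v a b : (forall x, u x = v x) -> C_integral u a b = C_integral v a b.
Proof. intros H. apply (RInt_ext (V := C_R_CompleteNormedModule)). intros x _. apply H. Qed.

Lemma C_integral_plus u v a b : continuous_path u -> continuous_path v ->
  C_integral (fun x => u x + v x) a b = C_integral u a b + C_integral v a b.
Proof.
intros H K. apply C_integral_unique.
exact (is_RInt_plus _ _ _ _ _ _ (C_integral_correct u a b H) (C_integral_correct v a b K)).
Qed.

Lemma C_integral_minus u v a b : continuous_path u -> continuous_path v ->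
  C_integral (fun x => u x - v x) a b = C_integral u a b - C_integral v a b.
Proof.
intros H K. apply C_integral_unique.
exact (is_RInt_minus _ _ _ _ _ _ (C_integral_correct u a b H) (C_integral_correct v a b K)).
Qed.

Lemma is_RInt_C (u : R -> C) a b (l : C) :
  is_RInt (fun x => fst (u x)) a b (fst l) ->
  is_RInt (fun x => snd (u x)) a b (snd l) ->
  @is_RInt C_R_CompleteNormedModule u a b l.
Proof.
intros H K. destruct l as [l1 l2].
exact (is_RInt_fct_extend_pair (U := R_NormedModule) (V := R_NormedModule) u a b l1 l2 H K).
Qed.

Lemma is_RInt_C_fst (u : R -> C) a b (l : C) :
  @is_RInt C_R_CompleteNormedModule u a b l ->
  is_RInt (fun x => fst (u x)) a b (fst l).
Proof. exact (is_RInt_fct_extend_fst (U := R_NormedModule) (V := R_NormedModule) u a b l). Qed.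

Lemma is_RInt_C_snd (u : R -> C) a b (l : C) :
  @is_RInt C_R_CompleteNormedModule u a b l ->
  is_RInt (fun x => snd (u x)) a b (snd l).
Proof. exact (is_RInt_fct_extend_snd (U := R_NormedModule) (V := R_NormedModule) u a b l). Qed.

Lemma C_integral_mult c u a b : continuous_path u -> C_integral (fun x => c * u x)
    a b = c * C_integral u a b.
Proof.
intros H. apply C_integral_unique. pose proof (C_integral_correct u a b H) as K.
pose proof (is_RInt_C_fst _ _ _ _ K) as K1. pose proof (is_RInt_C_snd _ _ _ _ K) as K2.
apply is_RInt_C; simpl.
- exact (is_RInt_minus _ _ _ _ _ _ (is_RInt_scal _ _ _ (fst c) _ K1)
           (is_RInt_scal _ _ _ (snd c) _ K2)).
- exact (is_RInt_plus _ _ _ _ _ _ (is_RInt_scal _ _ _ (fst c) _ K2)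
           (is_RInt_scal _ _ _ (snd c) _ K1)).
Qed.

Lemma C_integral_Chasles u a b c : continuous_path u -> C_integral u a b + C_integral u b c =
    C_integral u a c.
Proof.
intros H. symmetry. apply C_integral_unique.
exact (is_RInt_Chasles _ _ _ _ _ _ (C_integral_correct u a b H) (C_integral_correct u b c H)).
Qed.

Lemma C_integral_bound u a b M : continuous_path u -> (a <= b)%R ->
  (forall x, (a <= x <= b)%R -> (Cmod (u x) <= M)%R) ->
  (Cmod (C_integral u a b) <= (b - a) * M)%R.
Proof.
intros H Hab HM. rewrite Cmod_norm.
apply (norm_RInt_le_const (V := C_R_CompleteNormedModule) u a b (C_integral u a b) M Hab).
- intros x Hx. specialize (HM x Hx). rewrite Cmod_norm in HM. exact HM.
- apply C_integral_correct; exact H.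
Qed.

(** * Goursat's lemma in polar coordinates *)

Open Scope R_scope.

(** The dyadic argument behind Goursat's lemma: if [Q] failed on the whole
    rectangle it would fail on one quarter, hence on a nested sequence of
    rectangles that shrinks to a point [(u, v)], against the local hypothesis. *)
Lemma bisection (Q : R -> R -> R -> R -> Prop) :
  (forall x0 x1 x2 y0 y1 y2, (x1 - x0 = x2 - x1)%R -> (y1 - y0 = y2 - y1)%R ->
     (x0 <= x1)%R -> (y0 <= y1)%R ->
     Q x0 x1 y0 y1 -> Q x0 x1 y1 y2 -> Q x1 x2 y0 y1 -> Q x1 x2 y1 y2 ->
     Q x0 x2 y0 y2) ->
  forall X0 X1 Y0 Y1, (X0 <= X1)%R -> (Y0 <= Y1)%R ->
  (forall u v, (X0 <= u <= X1)%R -> (Y0 <= v <= Y1)%R ->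
     exists del, (0 < del)%R /\ forall x0 x1 y0 y1,
       (X0 <= x0 <= u)%R -> (u <= x1 <= X1)%R -> (Y0 <= y0 <= v)%R -> (v <= y1 <= Y1)%R ->
       (x1 - x0 < del)%R -> (y1 - y0 < del)%R -> Q x0 x1 y0 y1) ->
  Q X0 X1 Y0 Y1.
Proof.
intros Hsplit X0 X1 Y0 Y1 HX HY Hloc.
destruct (excluded_middle_informative (Q X0 X1 Y0 Y1)) as [|HN]; [assumption|exfalso].
set (a := (X1 - X0)%R). set (b := (Y1 - Y0)%R).
assert (Hstep : forall (n : nat) (p : R * R),
  exists p' : R * R,
   ~ Q (fst p) (fst p + a / 2 ^ n)%R (snd p) (snd p + b / 2 ^ n)%R ->
   ~ Q (fst p') (fst p' + a / 2 ^ S n)%R (snd p') (snd p' + b / 2 ^ S n)%R /\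
   (fst p <= fst p')%R /\ (fst p' + a / 2 ^ S n <= fst p + a / 2 ^ n)%R /\
   (snd p <= snd p')%R /\ (snd p' + b / 2 ^ S n <= snd p + b / 2 ^ n)%R).
{ intros n [x y]; simpl fst; simpl snd.
  assert (P2 : (0 < 2 ^ n)%R) by (apply pow_lt; lra).
  assert (Ha : (0 <= a / 2 ^ S n)%R).
  { apply Rmult_le_pos; [unfold a; lra|]. left; apply Rinv_0_lt_compat; apply pow_lt; lra. }
  assert (Hb : (0 <= b / 2 ^ S n)%R).
  { apply Rmult_le_pos; [unfold b; lra|]. left; apply Rinv_0_lt_compat; apply pow_lt; lra. }
  assert (Ea : (a / 2 ^ n = a / 2 ^ S n + a / 2 ^ S n)%R) by (simpl; field; lra).
  assert (Eb : (b / 2 ^ n = b / 2 ^ S n + b / 2 ^ S n)%R) by (simpl; field; lra).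
  rewrite Ea, Eb. set (a' := (a / 2 ^ S n)%R) in *. set (b' := (b / 2 ^ S n)%R) in *.
  destruct (excluded_middle_informative (Q x (x + a') y (y + b'))) as [q1|q1].
  2: { exists (x, y); intros _; simpl; repeat split; auto; lra. }
  destruct (excluded_middle_informative (Q x (x + a') (y + b') (y + b' + b'))) as [q2|q2].
  2: { exists (x, (y + b')%R); intros _; simpl; repeat split; auto; lra. }
  destruct (excluded_middle_informative (Q (x + a') (x + a' + a') y (y + b'))) as [q3|q3].
  2: { exists ((x + a')%R, y); intros _; simpl; repeat split; auto; lra. }
  destruct (excluded_middle_informative (Q (x + a') (x + a' + a') (y + b') (y + b' + b'))) as [q4|q4].
  2: { exists ((x + a')%R, (y + b')%R); intros _; simpl; repeat split; auto; lra. }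
  exists (x, y). intros N. exfalso; apply N.
  rewrite <- !Rplus_assoc. apply (Hsplit x (x + a')%R _ y (y + b')%R _); auto; lra. }
set (step := fun n p => proj1_sig (constructive_indefinite_description _ (Hstep n p))).
assert (step_spec : forall n p, _) by (intros n p;
    exact (proj2_sig (constructive_indefinite_description _ (Hstep n p)))).
set (sq := fix sq n := match n with O => (X0, Y0) | S n => step n (sq n) end).
assert (Hsq : forall n, ~ Q (fst (sq n)) (fst (sq n) + a / 2 ^ n)%R (snd (sq n))
    (snd (sq n) + b / 2 ^ n)%R).
{ induction n as [|n IH].
  - simpl. unfold Rdiv; rewrite Rinv_1, !Rmult_1_r.
    replace (X0 + a)%R with X1 by (unfold a; ring). replace (Y0 + b)%R with Y1 by (unfold b;
        ring). exact HN.
  - exact (proj1 (step_spec n (sq n) IH)). }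
assert (Hin : forall n,
   fst (sq n) <= fst (sq (S n)) /\ fst (sq (S n)) + a / 2 ^ S n <= fst (sq n) + a / 2 ^ n /\
   snd (sq n) <= snd (sq (S n)) /\ snd (sq (S n)) + b / 2 ^ S n <= snd (sq n) + b / 2 ^ n)
  by (intros n; exact (proj2 (step_spec n (sq n) (Hsq n)))).
clear step_spec.
assert (lim : forall (xs : nat -> R) c, (0 <= c)%R ->
  (forall n, (xs n <= xs (S n))%R /\ (xs (S n) + c / 2 ^ S n <= xs n + c / 2 ^ n)%R) ->
  exists u, forall n, (xs n <= u <= xs n + c / 2 ^ n)%R).
{ intros xs c Hc H.
  assert (M1 : forall n m, (n <= m)%nat -> (xs n <= xs m)%R).
  { induction 1 as [|m' L IH]; [lra|]. pose proof (H m'); lra. }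
  assert (M2 : forall n m, (n <= m)%nat -> (xs m + c / 2 ^ m <= xs n + c / 2 ^ n)%R).
  { induction 1 as [|m' L IH]; [lra|]. pose proof (H m'); lra. }
  assert (M3 : forall n, (0 <= c / 2 ^ n)%R).
  { intros n. apply Rmult_le_pos; [auto|]. left; apply Rinv_0_lt_compat; apply pow_lt; lra. }
  assert (M4 : forall n m, (xs n <= xs m + c / 2 ^ m)%R).
  { intros n m. destruct (Nat.le_ge_cases n m) as [L|L].
    - pose proof (M1 n m L); pose proof (M3 m); lra.
    - pose proof (M2 m n L); pose proof (M3 n); lra. }
  destruct (completeness (fun r => exists n, r = xs n)) as [u [U1 U2]].
  - exists (xs 0%nat + c / 2 ^ 0)%R. intros r [n ->]. apply M4.
  - exists (xs 0%nat), 0%nat; reflexivity.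
  - exists u; intros n; split.
    + apply U1; exists n; reflexivity.
    + apply U2. intros r [m ->]. apply M4. }
destruct (lim (fun n => fst (sq n)) a) as [u Hu]; [unfold a; lra|intros n; destruct (Hin n)
    as [E1 [E2 _]]; split; [exact E1|exact E2]|].
destruct (lim (fun n => snd (sq n)) b) as [v Hv]; [unfold b; lra|intros n; destruct (Hin n)
    as [_ [_ [E1 E2]]]; split; [exact E1|exact E2]|].
assert (B : forall n, (X0 <= fst (sq n) /\ fst (sq n) + a / 2 ^ n <= X1 /\ Y0 <= snd (sq n)
    /\ snd (sq n) + b / 2 ^ n <= Y1)%R).
{ induction n as [|n IH]; [simpl; unfold a, b; lra|]. destruct (Hin n) as [? [? [? ?]]],
    IH as [? [? [? ?]]]. repeat split; lra. }
destruct (Hloc u v) as [del [Hd Hq]].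
{ pose proof (B 0%nat); pose proof (Hu 0%nat); lra. }
{ pose proof (B 0%nat); pose proof (Hv 0%nat); lra. }
assert (Hn : exists n, ((a + b) / 2 ^ n < del)%R).
{ assert (L : (0 <= a + b)%R) by (unfold a, b; lra).
  destruct (pow_lt_1_zero (/2) ltac:(rewrite Rabs_pos_eq; lra) (del / (a + b + 1))) as [N HNN].
  { apply Rdiv_lt_0_compat; lra. }
  exists N. specialize (HNN N (le_n N)).
  rewrite Rabs_pos_eq in HNN by (apply pow_le; lra). rewrite pow_inv in HNN.
  apply Rle_lt_trans with ((a + b + 1) * / 2 ^ N)%R.
  - apply Rmult_le_compat_r; [|lra]. left; apply Rinv_0_lt_compat; apply pow_lt; lra.
  - apply Rmult_lt_compat_l with (r := (a + b + 1)%R) in HNN; [|lra].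
    replace ((a + b + 1) * (del / (a + b + 1)))%R with del in HNN by (field; lra). exact HNN. }
destruct Hn as [n Hn].
assert (P2 : (0 < / 2 ^ n)%R) by (apply Rinv_0_lt_compat, pow_lt; lra).
assert (A1 : (0 <= a / 2 ^ n)%R) by (apply Rmult_le_pos; [unfold a; lra|lra]).
assert (A2 : (0 <= b / 2 ^ n)%R) by (apply Rmult_le_pos; [unfold b; lra|lra]).
replace ((a + b) / 2 ^ n)%R with (a / 2 ^ n + b / 2 ^ n)%R in Hn by (unfold Rdiv; ring).
apply (Hsq n). apply Hq; pose proof (B n); pose proof (Hu n); pose proof (Hv n); lra.
Qed.

Open Scope C_scope.

Definition separately_continuous (G : R -> R -> C) : Prop :=
  (forall s, continuous_path (G s)) /\ (forall t, continuous_path (fun s => G s t)).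

(** With [gamma (s, t) = z0 + exp s * k t], [kap = k' / k] and
    [G = f o gamma], this is the integral of [f (z) / (z - z0) dz] along the image
    under [gamma] of the boundary of the rectangle: [d gamma / (gamma - z0)] is
    [ds] on the sides where [t] is constant and [kap dt] on the others. The
    coordinate [s] is the logarithm of the dilation of center [z0], which removes
    the denominators and keeps every integrand continuous for all [s]. *)
Definition boundary_integral (kap : R -> C) (G : R -> R -> C) (x0 x1 y0 y1 : R) : C :=
  C_integral (fun t => (G x1 t - G x0 t) * kap t) y0 y1 - C_integral (fun s => G s y1 - G s y0) x0 x1.

Lemma boundary_integral_split_x kap G x0 x1 x2 y0 y1 : continuous_path kap -> separately_continuous G ->
  boundary_integral kap G x0 x2 y0 y1
  = boundary_integral kap G x0 x1 y0 y1 + boundary_integral kap G x1 x2 y0 y1.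
Proof.
intros Hk [H1 H2]. unfold boundary_integral.
rewrite <- (C_integral_Chasles (fun s => G s y1 - G s y0) x0 x1 x2)
    by (apply continuous_path_minus; auto).
rewrite (C_integral_ext (fun t => (G x2 t - G x0 t) * kap t)
  (fun t => (G x1 t - G x0 t) * kap t + (G x2 t - G x1 t) * kap t)) by (intros; ring).
rewrite C_integral_plus by (apply continuous_path_mult; [apply continuous_path_minus|]; auto).
ring.
Qed.

Lemma boundary_integral_split_y kap G x0 x1 y0 y1 y2 : continuous_path kap -> separately_continuous G ->
  boundary_integral kap G x0 x1 y0 y2 = boundary_integral kap G x0 x1 y0 y1 + boundary_integral
      kap G x0 x1 y1 y2.
Proof.
intros Hk [H1 H2]. unfold boundary_integral.
rewrite <- (C_integral_Chasles (fun t => (G x1 t - G x0 t) * kap t) y0 y1 y2)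
  by (apply continuous_path_mult; [apply continuous_path_minus|]; auto).
rewrite (C_integral_ext (fun s => G s y2 - G s y0)
  (fun s => (G s y1 - G s y0) + (G s y2 - G s y1))) by (intros; ring).
rewrite C_integral_plus by (apply continuous_path_minus; auto).
ring.
Qed.

Lemma boundary_integral_plus kap G H x0 x1 y0 y1 : continuous_path kap -> separately_continuous
    G -> separately_continuous H ->
  boundary_integral kap (fun s t => G s t + H s t) x0 x1 y0 y1
  = boundary_integral kap G x0 x1 y0 y1 + boundary_integral kap H x0 x1 y0 y1.
Proof.
intros Hk [G1 G2] [H1 H2]. unfold boundary_integral.
rewrite (C_integral_ext (fun t => (G x1 t + H x1 t - (G x0 t + H x0 t)) * kap t)
  (fun t => (G x1 t - G x0 t) * kap t + (H x1 t - H x0 t) * kap t)) by (intros; ring).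
rewrite (C_integral_ext (fun s => G s y1 + H s y1 - (G s y0 + H s y0))
  (fun s => (G s y1 - G s y0) + (H s y1 - H s y0))) by (intros; ring).
rewrite (C_integral_plus (fun t => (G x1 t - G x0 t) * kap t) (fun t => (H x1 t - H x0 t) * kap t))
  by (apply continuous_path_mult; [apply continuous_path_minus|]; auto).
rewrite (C_integral_plus (fun s => G s y1 - G s y0) (fun s => H s y1 - H s y0))
    by (apply continuous_path_minus; auto).
ring.
Qed.

Lemma boundary_integral_small kap G x0 x1 y0 y1 M L : continuous_path kap -> separately_continuous G ->
  (x0 <= x1)%R -> (y0 <= y1)%R ->
  (forall t, (Cmod (kap t) <= L)%R) ->
  (forall s t, (x0 <= s <= x1)%R -> (y0 <= t <= y1)%R -> (Cmod (G s t) <= M)%R) ->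
  (Cmod (boundary_integral kap G x0 x1 y0 y1) <= 2 * M * (L * (y1 - y0) + (x1 - x0)))%R.
Proof.
intros Hk [G1 G2] Hx Hy HL HM. unfold boundary_integral, Cminus.
eapply Rle_trans; [apply Cmod_triangle|]. rewrite Cmod_opp.
assert (M0 : (0 <= M)%R) by (eapply Rle_trans; [apply Cmod_ge_0|apply (HM x0 y0); lra]).
assert (D : forall u v, (Cmod u <= M)%R -> (Cmod v <= M)%R -> (Cmod (u + - v)%C <= 2 * M)%R).
{ intros u v Hu Hv. eapply Rle_trans; [apply Cmod_triangle|]. rewrite Cmod_opp. lra. }
assert (B1 : (Cmod (C_integral (fun t => ((G x1 t + - G x0 t) * kap t)%C) y0 y1)
    <= (y1 - y0) * (2 * M * L))%R).
{ apply C_integral_bound; [|lra|].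
  - apply continuous_path_mult; [apply continuous_path_minus|]; auto.
  - intros t Ht. rewrite Cmod_mult. apply Rmult_le_compat; try apply Cmod_ge_0; [|apply HL].
    apply D; apply HM; lra. }
assert (B2 : (Cmod (C_integral (fun s => (G s y1 + - G s y0)%C) x0 x1) <= (x1 - x0) * (2 * M))%R).
{ apply C_integral_bound; [|lra|].
  - apply continuous_path_minus; auto.
  - intros t Ht. apply D; apply HM; lra. }
lra.
Qed.

Lemma continuous_path_exp : continuous_path (fun s => RtoC (exp s)).
Proof. intros s. apply C_continuous_RtoC. apply (ex_derive_continuous exp). exists (exp s).
    apply is_derive_exp. Qed.

Lemma C_integral_exp a b : C_integral (fun s => RtoC (exp s)) a b = RtoC (exp b - exp a).
Proof.
apply C_integral_unique. apply is_RInt_C; simpl.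
- apply (is_RInt_derive (V := R_CompleteNormedModule) exp exp).
  + intros; apply is_derive_exp.
  + intros x _. apply (ex_derive_continuous exp). exists (exp x). apply is_derive_exp.
- pose proof (is_RInt_const (V := R_NormedModule) a b 0%R) as H.
  unfold scal in H; simpl in H; unfold mult in H; simpl in H. rewrite Rmult_0_r in H. exact H.
Qed.

(** For [f (z) = al + be * (z - z0)] the integrand is [al / (z - z0) + be]: the first
    part contributes opposite terms on opposite sides, and the second has a
    primitive. *)
Lemma boundary_integral_affine (k dk : R -> C) (al be : C) x0 x1 y0 y1 :
  continuous_path k -> continuous_path dk -> (forall t, k t <> 0) ->
  (forall a b, C_integral dk a b = k b - k a) ->
  boundary_integral (fun t => dk t * / k t) (fun s t => al + be * (RtoC (exp s) * k t)) x0 x1 y0 y1 = 0.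
Proof.
intros Hk Hdk H0 F. unfold boundary_integral.
rewrite (C_integral_ext _ (fun t => be * RtoC (exp x1 - exp x0) * dk t)).
2: { intros t. rewrite RtoC_minus. field. apply H0. }
rewrite (C_integral_ext (fun s => al + be * (RtoC (exp s) * k y1) - (al + be * (RtoC (exp s) * k y0)))
  (fun s => be * (k y1 - k y0) * RtoC (exp s))) by (intros; ring).
rewrite !C_integral_mult by (auto; apply continuous_path_exp).
rewrite F, C_integral_exp. ring.
Qed.

Lemma exp_lip a b : (a <= 0)%R -> (b <= 0)%R -> (Rabs (exp a - exp b) <= Rabs (a - b))%R.
Proof.
assert (H : forall a b, (a <= b)%R -> (b <= 0)%R -> (0 <= exp b - exp a <= b - a)%R).
{ clear. intros a b H H0. split.
  - destruct H as [H| ->]; [|lra]. pose proof (exp_increasing _ _ H); lra.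
  - pose proof (exp_ineq1_le (a - b)) as E. pose proof (exp_pos b).
    assert (exp b <= 1)%R by (rewrite <- exp_0; destruct H0 as [H0| ->]; [left;
        apply exp_increasing; auto|lra]).
    replace (exp a) with (exp b * exp (a - b))%R by (rewrite <- exp_plus; f_equal; ring).
    nra. }
intros Ha Hb. destruct (Rle_dec a b) as [L|L].
- destruct (H a b L Hb). rewrite Rabs_minus_sym, (Rabs_minus_sym a b), !Rabs_pos_eq; lra.
- destruct (H b a) as [? ?]; [lra|lra|]. rewrite !Rabs_pos_eq; lra.
Qed.

(** Near a point of the rectangle, [f] is affine up to an error [e * |z - z*|].
    The affine part contributes nothing, so a rectangle of sides [p] and [q]
    around the point contributes [O (e * (p + q) * (p + q))], which is
    [O (e * (p * p + q * q))]. This bound is inherited from the four quarters of a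
    rectangle, so bisection extends it to the whole one, and [e] is arbitrary. *)
Lemma goursat (f : C -> C) (k dk : R -> C) (z0 : C) (Kb Lb r S T0 T1 : R) :
  holomorphic f -> continuous_path k -> continuous_path dk -> (forall t, k t <> 0) ->
  (forall a b, C_integral dk a b = k b - k a) ->
  (forall t, (Cmod (k t) <= Kb)%R) -> (forall t, (Cmod (dk t) <= r)%R) ->
  (forall t, (Cmod (dk t * / k t) <= Lb)%R) ->
  (S <= 0)%R -> (T0 <= T1)%R ->
  boundary_integral (fun t => dk t * / k t) (fun s t => f (z0 + RtoC (exp s) * k t)) S 0 T0 T1 = 0.
Proof.
intros Hf Hk Hdk H0 F HKb Hr HLb HS HT.
set (kap := fun t => dk t * / k t).
set (g := fun s t => z0 + RtoC (exp s) * k t).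
assert (Ckap : continuous_path kap) by (intros t; apply C_continuous_mult;
    [apply Hdk|apply C_continuous_inv; auto]).
assert (fc : forall u, continuous_path u -> continuous_path (fun x => f (u x))).
{ intros u Hu x. destruct (Hf (u x)) as [l Hl]. apply (C_continuous_comp u f x (Hu x)).
    exact (has_deriv_C_continuous _ _ _ Hl). }
assert (Cg1 : forall s, continuous_path (g s)).
{ intros s; apply continuous_path_plus; [apply continuous_path_const|];
    apply continuous_path_mult; [apply continuous_path_const|auto]. }
assert (Cg2 : forall t, continuous_path (fun s => g s t)).
{ intros t; apply continuous_path_plus; [apply continuous_path_const|];
    apply continuous_path_mult; [apply continuous_path_exp|apply continuous_path_const]. }
assert (CG : separately_continuous (fun s t => f (g s t))).
{ split; intros; [apply (fc (g s)); auto | apply (fc (fun s => g s t)); auto]. }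
assert (Kb0 : (0 <= Kb)%R) by (eapply Rle_trans; [apply Cmod_ge_0|apply (HKb 0%R)]).
assert (r0 : (0 <= r)%R) by (eapply Rle_trans; [apply Cmod_ge_0|apply (Hr 0%R)]).
assert (Lb0 : (0 <= Lb)%R) by (eapply Rle_trans; [apply Cmod_ge_0|apply (HLb 0%R)]).
assert (klip : forall a b, (Cmod (k b - k a) <= r * Rabs (b - a))%R).
{ assert (A : forall a b, (a <= b)%R -> (Cmod (k b - k a) <= r * Rabs (b - a))%R).
  { intros a b Hab. rewrite <- F, Rabs_pos_eq by lra. rewrite Rmult_comm. apply C_integral_bound; auto. }
  intros a b. destruct (Rle_dec a b) as [L|L]; [auto|].
  replace (k b - k a) with (- (k a - k b)) by ring. rewrite Cmod_opp, Rabs_minus_sym. apply A; lra. }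
set (B := (Kb + r)%R).
assert (glip : forall s s' t t', (s <= 0)%R -> (s' <= 0)%R ->
  (Cmod (g s t - g s' t') <= B * (Rabs (s - s') + Rabs (t - t')))%R).
{ intros s s' t t' Hs Hs'. unfold g.
  replace (z0 + RtoC (exp s) * k t - (z0 + RtoC (exp s') * k t'))
    with (RtoC (exp s - exp s') * k t + RtoC (exp s') * (k t - k t')) by (rewrite RtoC_minus; ring).
  eapply Rle_trans; [apply Cmod_triangle|]. rewrite !Cmod_mult, !Cmod_R.
  assert (E : (Rabs (exp s') <= 1)%R).
  { rewrite Rabs_pos_eq by (left; apply exp_pos). rewrite <- exp_0.
    destruct Hs' as [H'| ->]; [left; apply exp_increasing; auto|lra]. }
  pose proof (exp_lip s s' Hs Hs'). pose proof (klip t' t).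
  pose proof (Cmod_ge_0 (k t)). pose proof (Cmod_ge_0 (k t - k t')). pose proof (HKb t).
  pose proof (Rabs_pos (s - s')). pose proof (Rabs_pos (t - t')). pose proof (Rabs_pos (exp s')).
      pose proof (Rabs_pos (exp s - exp s')).
  assert (Rabs (exp s - exp s') * Cmod (k t) <= Rabs (s - s') * Kb)%R by (apply Rmult_le_compat; auto).
  assert (Rabs (exp s') * Cmod (k t - k t')
      <= 1 * (r * Rabs (t - t')))%R by (apply Rmult_le_compat; auto).
  unfold B. nra. }
assert (B0 : (0 <= B)%R) by (unfold B; lra).
apply Cmod_eq_0. apply Rle_antisym; [|apply Cmod_ge_0].
apply le_epsilon. intros eps0 Heps0. rewrite Rplus_0_l.
(* the total error allowed is [eps0]; [e] is its share per unit of [area] *)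
set (area := ((0 - S) * (0 - S) + (T1 - T0) * (T1 - T0))%R).
assert (area0 : (0 <= area)%R) by (unfold area; nra).
set (e := (eps0 / (area + 1))%R).
assert (e0 : (0 < e)%R) by (unfold e; apply Rdiv_lt_0_compat; lra).
set (c := (4 * B * (Lb + 1))%R).
assert (c0 : (0 <= c)%R) by (unfold c; apply Rmult_le_pos; lra).
apply Rle_trans with (e * area)%R.
2: { unfold e. apply Rmult_le_reg_r with (area + 1)%R; [lra|].
     replace (eps0 / (area + 1) * area * (area + 1))%R with (eps0 * area)%R by (field; lra). nra. }
unfold area.
apply (bisection (fun x0 x1 y0 y1 =>
  (Cmod (boundary_integral kap (fun s t => f (g s t)) x0 x1 y0 y1)
      <= e * ((x1 - x0) * (x1 - x0) + (y1 - y0) * (y1 - y0)))%R)); auto.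
- intros x0 x1 x2 y0 y1 y2 Ex Ey Hx Hy Q1 Q2 Q3 Q4.
  rewrite (boundary_integral_split_x _ _ x0 x1 x2) by auto.
  rewrite !(boundary_integral_split_y _ _ _ _ y0 y1 y2) by auto.
  eapply Rle_trans; [apply Cmod_triangle|].
  eapply Rle_trans; [apply Rplus_le_compat; apply Cmod_triangle|].
  replace (x2 - x0)%R with (2 * (x1 - x0))%R by lra.
  replace (y2 - y0)%R with (2 * (y1 - y0))%R by lra.
  rewrite <- Ex in Q3, Q4. rewrite <- Ey in Q2, Q4. lra.
- intros u v Hu Hv. destruct (Hf (g u v)) as [l Hl].
  set (e1 := (e / 2 / (c + 1))%R).
  assert (e10 : (0 < e1)%R) by (unfold e1; apply Rdiv_lt_0_compat; lra).
  assert (e1c : (2 * (e1 * c) <= e)%R).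
  { unfold e1. apply Rmult_le_reg_r with (c + 1)%R; [lra|].
    replace (2 * (e / 2 / (c + 1) * c) * (c + 1))%R with (e * c)%R by (field; lra). nra. }
  destruct (has_deriv_eps _ _ _ Hl e1 e10) as [del [Hdel HD]].
  exists (del / (2 * (B + 1)))%R. split; [apply Rdiv_lt_0_compat; lra|].
  intros x0 x1 y0 y1 Hx0 Hx1 Hy0 Hy1 Hxs Hys.
  set (aff := fun s t => (f (g u v) + l * (z0 - g u v)) + l * (RtoC (exp s) * k t)).
  set (rho := fun s t => f (g s t) - aff s t).
  assert (Caff : separately_continuous aff).
  { split; intros w.
    - apply (continuous_path_plus (fun _ => f (g u v) + l * (z0 - g u v))
        (fun t => l * (RtoC (exp w) * k t)));
        [apply continuous_path_const|].
      apply (continuous_path_mult (fun _ => l) (fun t => RtoC (exp w) * k t));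
          [apply continuous_path_const|].
      apply (continuous_path_mult (fun _ => RtoC (exp w)) k); [apply continuous_path_const|exact Hk].
    - apply (continuous_path_plus (fun _ => f (g u v) + l * (z0 - g u v))
        (fun s => l * (RtoC (exp s) * k w)));
        [apply continuous_path_const|].
      apply (continuous_path_mult (fun _ => l) (fun s => RtoC (exp s) * k w));
          [apply continuous_path_const|].
      apply (continuous_path_mult (fun s => RtoC (exp s)) (fun _ => k w));
          [apply continuous_path_exp|apply continuous_path_const]. }
  assert (Crho : separately_continuous rho).
  { split; intros.
    - apply (continuous_path_minus (fun t => f (g s t)) (fun t => aff s t));
        [apply (proj1 CG)|apply (proj1 Caff)].
    - apply (continuous_path_minus (fun s => f (g s t)) (fun s => aff s t));
        [apply (proj2 CG)|apply (proj2 Caff)]. }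
  replace (boundary_integral kap (fun s t => f (g s t)) x0 x1 y0 y1)
      with (boundary_integral kap rho x0 x1 y0 y1).
  2: { transitivity (boundary_integral kap (fun s t => rho s t + aff s t) x0 x1 y0 y1).
       - rewrite boundary_integral_plus by auto. unfold aff.
           rewrite (boundary_integral_affine k dk) by auto. ring.
       - unfold boundary_integral. apply (f_equal2 Cminus); apply C_integral_ext; intros;
           unfold rho; ring. }
  set (D := ((x1 - x0) + (y1 - y0))%R).
  assert (HD0 : (0 <= D)%R) by (unfold D; lra).
  eapply Rle_trans; [apply (boundary_integral_small kap rho x0 x1 y0 y1 (e1 * (B * D)) Lb); auto;
      try lra|].
  { intros s t Hs Ht. assert (G : (Cmod (g s t - g u v) <= B * D)%R).
    { eapply Rle_trans; [apply glip; lra|]. apply Rmult_le_compat_l; [auto|]. unfold D.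
      apply Rplus_le_compat; apply Rabs_le; lra. }
    replace (rho s t) with (f (g s t) - f (g u v) - l * (g s t - g u v)) by (unfold rho, aff, g; ring).
    eapply Rle_trans; [apply HD|].
    - eapply Rle_lt_trans; [exact G|].
      apply Rle_lt_trans with ((B + 1) * D)%R; [nra|].
      apply Rlt_le_trans with ((B + 1) * (del / (2 * (B + 1)) + del / (2 * (B + 1))))%R.
      + apply Rmult_lt_compat_l; [lra|unfold D; lra].
      + right; field; lra.
    - apply Rmult_le_compat_l; [lra|exact G]. }
  assert (I1 : (Lb * (y1 - y0) + (x1 - x0) <= (Lb + 1) * D)%R) by (unfold D;
      clear - Hx0 Hx1 Hy0 Hy1 Lb0; nra).
  assert (I2 : (0 <= e1 * (B * D))%R) by (apply Rmult_le_pos; [lra|apply Rmult_le_pos; auto]).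
  apply Rle_trans with (2 * (e1 * (B * D)) * ((Lb + 1) * D))%R; [apply Rmult_le_compat_l; lra|].
  replace (2 * (e1 * (B * D)) * ((Lb + 1) * D))%R with (e1 * c / 2 * (D * D))%R by (unfold c; field).
  pose proof (Rle_0_sqr ((x1 - x0) - (y1 - y0))) as I3.
  pose proof (Rle_0_sqr (x1 - x0)) as I4. pose proof (Rle_0_sqr (y1 - y0)) as I5.
      unfold Rsqr in I3, I4, I5.
  assert (I6 : (D * D <= 2 * ((x1 - x0) * (x1 - x0) + (y1 - y0) * (y1 - y0)))%R) by (unfold D; lra).
  apply Rle_trans with (e1 * c / 2 * (2 * ((x1 - x0) * (x1 - x0) + (y1 - y0) * (y1 - y0))))%R.
  + apply Rmult_le_compat_l; [|exact I6]. assert (0 <= e1 * c)%R by (apply Rmult_le_pos; lra). lra.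
  + replace (e1 * c / 2 * (2 * ((x1 - x0) * (x1 - x0) + (y1 - y0) * (y1 - y0))))%R
      with (e1 * c * ((x1 - x0) * (x1 - x0) + (y1 - y0) * (y1 - y0)))%R by field.
    apply Rmult_le_compat_r; lra.
Qed.

(** * Cauchy's formula and Taylor's expansion *)

Lemma Cmult_cancel_l (z x y : C) : z <> 0 -> z * x = z * y -> x = y.
Proof.
intros Hz E. transitivity (/ z * (z * x)); [field; auto|]. rewrite E. field; auto.
Qed.

Fixpoint csum (u : nat -> C) (n : nat) : C :=
  match n with O => 0 | S m => csum u m + u m end.

Lemma csum_ext u v n : (forall j, (j < n)%nat -> u j = v j) -> csum u n = csum v n.
Proof.
induction n as [|n IH]; intros H; simpl; [reflexivity|].
rewrite IH by (intros; apply H; lia). rewrite H by lia. reflexivity.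
Qed.

Lemma csum_mult c u n : c * csum u n = csum (fun j => c * u j) n.
Proof. induction n as [|n IH]; simpl; [ring|]. rewrite <- IH; ring. Qed.

Lemma continuous_path_csum (u : nat -> R -> C) n :
  (forall j, continuous_path (u j)) -> continuous_path (fun t => csum (fun j => u j t) n).
Proof.
intros H. induction n as [|n IH]; simpl; [apply continuous_path_const|].
exact (continuous_path_plus _ _ IH (H n)).
Qed.

Lemma C_integral_csum (u : nat -> R -> C) n a b : (forall j, continuous_path (u j)) ->
  C_integral (fun t => csum (fun j => u j t) n) a b = csum (fun j => C_integral (u j) a b) n.
Proof.
intros H. induction n as [|n IH]; simpl.
- pose proof (C_integral_mult 0 (fun _ => 0) a b (continuous_path_const 0)) as E.
  rewrite (C_integral_ext _ (fun _ => 0)) in E by (intros; ring). rewrite E. ring.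
- rewrite (C_integral_plus (fun t => csum (fun j => u j t) n) (u n)).
  + rewrite IH. reflexivity.
  + apply continuous_path_csum; auto.
  + auto.
Qed.

Definition circle (r t : R) : C := ((r * cos t)%R, (r * sin t)%R).

Lemma continuous_path_circle r : continuous_path (circle r).
Proof.
assert (H : forall x, C_continuous (fun t => RtoC (r * cos t) + Ci * RtoC (r * sin t)) x).
{ intros x. apply C_continuous_plus; [|apply C_continuous_mult; [apply C_continuous_const|]];
    apply C_continuous_RtoC;
    apply (ex_derive_continuous (V := R_NormedModule)); auto_derive; auto. }
replace (circle r) with (fun t => RtoC (r * cos t) + Ci * RtoC (r * sin t)); [exact H|].
apply functional_extensionality. intros t. apply injective_projections; simpl; ring.
Qed.

Lemma Cmod_circle r t : (0 <= r)%R -> Cmod (circle r t) = r.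
Proof.
intros H. unfold circle, Cmod; simpl.
replace (r * cos t * (r * cos t * 1) + r * sin t * (r * sin t * 1))%R
  with (r * r * (Rsqr (sin t) + Rsqr (cos t)))%R by (unfold Rsqr; ring).
rewrite sin2_cos2, Rmult_1_r. apply sqrt_square; auto.
Qed.

Lemma circle_neq_0 r t : (0 < r)%R -> circle r t <> 0.
Proof. intros H. apply Cmod_gt_0. rewrite Cmod_circle; lra. Qed.

Lemma is_RInt_FTC (F f : R -> R) a b l :
  (forall x, is_derive F x (f x)) -> (forall x, continuous f x) -> (F b - F a = l)%R ->
  is_RInt f a b l.
Proof.
intros H K <-. apply (is_RInt_derive (V := R_CompleteNormedModule) F f); auto.
Qed.

Lemma C_integral_dcircle r a b : C_integral (fun t => Ci * circle r t) a b = circle r b - circle r a.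
Proof.
apply C_integral_unique. apply is_RInt_C; simpl.
- apply (is_RInt_FTC (fun t => (r * cos t)%R)); [| |ring].
  + intros x. auto_derive; auto. ring.
  + intros x. apply (ex_derive_continuous (V := R_NormedModule)); auto_derive; auto.
- apply (is_RInt_FTC (fun t => (r * sin t)%R)); [| |ring].
  + intros x. auto_derive; auto. ring.
  + intros x. apply (ex_derive_continuous (V := R_NormedModule)); auto_derive; auto.
Qed.

Lemma inv_circle_pow r t n : (0 < r)%R ->
  (/ circle r t) ^ n = RtoC (/ r ^ n) * (cos (INR n * t), (- sin (INR n * t))%R).
Proof.
intros H. induction n as [|n IH].
- simpl. rewrite Rmult_0_l, cos_0, sin_0, Rinv_1. apply injective_projections; simpl; ring.
- rewrite Cpow_S, IH, S_INR.
  assert (E : / circle r t = RtoC (/ r) * (cos t, (- sin t)%R)).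
  { apply Cmult_cancel_l with (circle r t); [apply circle_neq_0; auto|].
    rewrite Cinv_r by (apply circle_neq_0; auto).
    pose proof (sin2_cos2 t) as S. unfold Rsqr in S.
    apply injective_projections; simpl; field_simplify; try lra; simpl; nra. }
  rewrite E. replace ((INR n + 1) * t)%R with (INR n * t + t)%R by ring.
  rewrite cos_plus, sin_plus.
  apply injective_projections; simpl; field; split; try lra; apply pow_nonzero; lra.
Qed.

Lemma C_integral_inv_circle_pow r n : (0 < r)%R ->
  C_integral (fun t => (/ circle r t) ^ n) 0 (2 * PI) = match n with O => RtoC (2 * PI) | _ => 0 end.
Proof.
intros H. destruct n as [|n].
- apply C_integral_unique. apply is_RInt_C; simpl.
  + pose proof (is_RInt_const (V := R_NormedModule) 0 (2 * PI) 1%R) as K.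
    unfold scal in K; simpl in K; unfold mult in K; simpl in K.
    replace ((2 * PI - 0) * 1)%R with (2 * PI)%R in K by ring. exact K.
  + pose proof (is_RInt_const (V := R_NormedModule) 0 (2 * PI) 0%R) as K.
    unfold scal in K; simpl in K; unfold mult in K; simpl in K.
    rewrite Rmult_0_r in K. exact K.
- rewrite (C_integral_ext _ _ _ _ (fun t => inv_circle_pow r t (S n) H)).
  apply C_integral_unique. set (m := INR (S n)).
  assert (Hm : (m <> 0)%R) by (unfold m; apply not_0_INR; lia).
  set (q := (/ r ^ S n)%R).
  apply is_RInt_C; simpl.
  + apply (is_RInt_FTC (fun t => (q * (sin (m * t) / m))%R)).
    * intros x. auto_derive; auto. field; auto.
    * intros x. apply (ex_derive_continuous (V := R_NormedModule)); auto_derive; auto.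
    * replace (m * (2 * PI))%R with (0 + 2 * INR (S n) * PI)%R by (unfold m; ring).
      rewrite sin_period, Rmult_0_r, sin_0. field; auto.
  + apply (is_RInt_FTC (fun t => (q * (cos (m * t) / m))%R)).
    * intros x. auto_derive; auto. field; auto.
    * intros x. apply (ex_derive_continuous (V := R_NormedModule)); auto_derive; auto.
    * replace (m * (2 * PI))%R with (0 + 2 * INR (S n) * PI)%R by (unfold m; ring).
      rewrite cos_period, Rmult_0_r. field; auto.
Qed.

Lemma continuous_path_pow u n : continuous_path u -> continuous_path (fun t => (u t) ^ n).
Proof.
intros H. induction n as [|n IH]; [exact (continuous_path_const 1)|].
exact (continuous_path_mult u (fun t => u t ^ n) H IH).
Qed.

Lemma continuous_path_inv u : continuous_path u -> (forall t,
    u t <> 0) -> continuous_path (fun t => / u t).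
Proof. intros H K x; apply C_continuous_inv; auto. Qed.

Lemma Cmod_circle_minus r t z : (0 <= r)%R -> (r - Cmod z <= Cmod (circle r t - z))%R.
Proof.
intros H. pose proof (Cmod_triangle (circle r t - z) z) as T.
replace (circle r t - z + z) with (circle r t) in T by ring.
rewrite Cmod_circle in T; lra.
Qed.

Lemma circle_minus_neq_0 r t z : (Cmod z < r)%R -> circle r t - z <> 0.
Proof.
intros H. pose proof (Cmod_ge_0 z). apply Cmod_gt_0.
pose proof (Cmod_circle_minus r t z). lra.
Qed.

(** Geometric expansion of Cauchy's kernel, stopped at order [M] and integrated
    against [g]. *)
Lemma kernel_expansion r z (g : R -> C) B M : (Cmod z < r)%R -> continuous_path g ->
  (forall t, (Cmod (g t) <= B)%R) ->
  (Cmod (C_integral (fun t => g t * (circle r t * / (circle r t - z))) 0 (2 * PI)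
     - csum (fun n => C_integral (fun t => g t * (/ circle r t) ^ n) 0 (2 * PI) * z ^ n) M)%C
   <= 2 * PI * (B * ((Cmod z / r) ^ M * (r / (r - Cmod z)))))%R.
Proof.
intros Hz Cg HB. pose proof (Cmod_ge_0 z) as Z0. assert (Hr : (0 < r)%R) by lra.
assert (N0 : forall t, circle r t <> 0) by (intros; apply circle_neq_0; auto).
assert (N1 : forall t, circle r t - z <> 0) by (intros; apply circle_minus_neq_0; auto).
assert (C1 : continuous_path (fun t => circle r t * / (circle r t - z))).
{ apply continuous_path_mult; [apply continuous_path_circle|]. apply continuous_path_inv; auto.
    apply continuous_path_minus; [apply continuous_path_circle|apply continuous_path_const]. }
assert (C2 : forall n, continuous_path (fun t => (/ circle r t) ^ n)).
{ intros n. apply (continuous_path_pow (fun t => / circle r t)). apply continuous_path_inv; auto.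
    apply continuous_path_circle. }
assert (C3 : forall n, continuous_path (fun t => z ^ n * (g t * (/ circle r t) ^ n))).
{ intros n. apply (continuous_path_mult (fun _ => z ^ n) (fun t => g t * (/ circle r t) ^ n));
    [apply continuous_path_const|].
  exact (continuous_path_mult g _ Cg (C2 n)). }
assert (C4 : continuous_path (fun t => g t * (z ^ M * (/ circle r t)
    ^ M * (circle r t * / (circle r t - z))))).
{ apply (continuous_path_mult g (fun t => z ^ M * (/ circle r t)
    ^ M * (circle r t * / (circle r t - z)))); [exact Cg|].
  apply (continuous_path_mult (fun t => z ^ M * (/ circle r t) ^ M) _); [|exact C1].
  exact (continuous_path_mult (fun _ => z ^ M) _ (continuous_path_const _) (C2 M)). }
rewrite (csum_ext _ (fun n => C_integral (fun t => z ^ n * (g t * (/ circle r t) ^ n)) 0 (2 * PI))).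
2: { intros n _. rewrite (C_integral_mult (z ^ n) (fun t => g t * (/ circle r t) ^ n)); [ring|].
     exact (continuous_path_mult g _ Cg (C2 n)). }
rewrite <- C_integral_csum by exact C3.
assert (K : forall t, circle r t * / (circle r t - z) =
   csum (fun n => z ^ n * (/ circle r t) ^ n) M + z ^ M * (/ circle r t)
       ^ M * (circle r t * / (circle r t - z))).
{ clear C4. intros t. induction M as [|M IH]; [simpl; ring|].
  rewrite IH at 1.
  simpl csum. rewrite !Cpow_S. field. auto. }
rewrite (C_integral_ext _ (fun t => csum (fun n => z ^ n * (g t * (/ circle r t) ^ n)) M
    + g t * (z ^ M * (/ circle r t) ^ M * (circle r t * / (circle r t - z))))).
2: { intros t. rewrite K at 1. rewrite Cmult_plus_distr_l, csum_mult. f_equal.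
     apply csum_ext; intros; ring. }
rewrite C_integral_plus by (try exact C4; apply continuous_path_csum; exact C3).
match goal with |- (Cmod (?a + ?b - ?a)%C <= _)%R => replace (a + b - a) with b by ring end.
rewrite <- (Rminus_0_r (2 * PI)) at 2.
apply C_integral_bound; [exact C4|pose proof PI_RGT_0; lra|].
intros t _. rewrite !Cmod_mult, !Cmod_pow, !Cmod_inv by auto.
rewrite Cmod_circle by lra.
apply Rmult_le_compat; auto; try apply Cmod_ge_0.
{ apply Rmult_le_pos; apply Rmult_le_pos; try lra; try (apply pow_le; lra).
  - apply pow_le. left; apply Rinv_0_lt_compat; lra.
  - left; apply Rinv_0_lt_compat. apply Cmod_gt_0; auto. }
unfold Rdiv. rewrite Rpow_mult_distr.
apply Rmult_le_compat_l.
{ apply Rmult_le_pos; apply pow_le; [lra|]. left; apply Rinv_0_lt_compat; lra. }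
apply Rmult_le_compat_l; [lra|]. apply Rinv_le_contravar; [lra|]. apply Cmod_circle_minus; lra.
Qed.

Lemma nonpos_of_geometric_bound x A q : (0 <= q < 1)%R -> (forall M : nat,
    (x <= A * q ^ M)%R) -> (x <= 0)%R.
Proof.
intros Hq H. apply le_epsilon. intros eps He. rewrite Rplus_0_l.
assert (A1 : (0 < Rabs A + 1)%R) by (pose proof (Rabs_pos A); lra).
destruct (pow_lt_1_zero q ltac:(rewrite Rabs_pos_eq; lra) (eps / (Rabs A + 1))) as [N HN].
{ apply Rdiv_lt_0_compat; lra. }
specialize (HN N (le_n N)). rewrite Rabs_pos_eq in HN by (apply pow_le; lra).
eapply Rle_trans; [apply (H N)|].
assert (P : (0 <= q ^ N)%R) by (apply pow_le; lra).
apply Rle_trans with ((Rabs A + 1) * q ^ N)%R.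
{ apply Rmult_le_compat_r; [auto|]. pose proof (Rle_abs A); lra. }
apply Rmult_lt_compat_l with (r := (Rabs A + 1)%R) in HN; [|lra].
replace ((Rabs A + 1) * (eps / (Rabs A + 1)))%R with eps in HN by (field; lra). lra.
Qed.

Lemma holomorphic_continuous_path f u : holomorphic f -> continuous_path u -> continuous_path
    (fun t => f (u t)).
Proof.
intros Hf Hu x. destruct (Hf (u x)) as [l Hl]. apply (C_continuous_comp u f x (Hu x)).
    exact (has_deriv_C_continuous _ _ _ Hl).
Qed.

Lemma C_integral_kernel r z : (Cmod z < r)%R ->
  C_integral (fun t => circle r t * / (circle r t - z)) 0 (2 * PI) = RtoC (2 * PI).
Proof.
intros Hz. pose proof (Cmod_ge_0 z) as Z0.
apply Ceq_minus, Cmod_eq_0. apply Rle_antisym; [|apply Cmod_ge_0].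
assert (Q : (0 <= Cmod z / r < 1)%R).
{ split; [apply Rmult_le_pos; [lra|left; apply Rinv_0_lt_compat; lra]|].
  apply Rmult_lt_reg_r with r; [lra|]. unfold Rdiv; rewrite Rmult_assoc, Rinv_l; lra. }
apply (nonpos_of_geometric_bound _ (2 * PI * (r / (r - Cmod z)) * (Cmod z / r)) (Cmod z / r) Q).
intros M. pose proof (kernel_expansion r z (fun _ => 1) 1 (S M) Hz (continuous_path_const 1)) as K.
specialize (K ltac:(intros; cbv beta; rewrite Cmod_1; apply Rle_refl)).
rewrite (C_integral_ext _ (fun t => circle r t * / (circle r t - z))) in K by (intros; ring).
replace (csum _ (S M)) with (RtoC (2 * PI)) in K.
- eapply Rle_trans; [exact K|]. right; simpl; ring.
- rewrite (csum_ext _ (fun n => match n with O => RtoC (2 * PI) | _ => 0 end)).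
  + clear. induction M as [|M IH]; [simpl; ring|]. change (csum ?u (S (S M))) with (csum u (S M) + 0).
    rewrite <- IH. ring.
  + intros n _. rewrite (C_integral_ext _ (fun t => (/ circle r t) ^ n)) by (intros; ring).
    rewrite C_integral_inv_circle_pow by lra. destruct n; simpl; ring.
Qed.

(** Goursat's lemma says that the integral of [f (z) / (z - z0)] is the same over
    all the curves [z0 + exp S * k t], which interpolate between the circle
    ([S = 0]) and the point [z0] ([S] tending to minus infinity). By continuity of
    [f] at [z0] the common value is [f z0] times the integral of the kernel. *)
Lemma cauchy f r z : holomorphic f -> (Cmod z < r)%R ->
  C_integral (fun t => f (circle r t) * (circle r t * / (circle r t - z))) 0 (2 * PI)
      = RtoC (2 * PI) * f z.
Proof.
intros Hf Hz. pose proof (Cmod_ge_0 z) as Z0. assert (Hr : (0 < r)%R) by lra.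
set (k := fun t => circle r t - z). set (dk := fun t => Ci * circle r t).
assert (N1 : forall t, k t <> 0) by (intros; apply circle_minus_neq_0; auto).
assert (Ck : continuous_path k) by (apply continuous_path_minus;
    [apply continuous_path_circle|apply continuous_path_const]).
assert (Cdk : continuous_path dk) by (apply continuous_path_mult;
    [apply continuous_path_const|apply continuous_path_circle]).
set (kap := fun t => dk t * / k t).
assert (Ckap : continuous_path kap) by (apply continuous_path_mult;
    [auto|apply continuous_path_inv; auto]).
assert (B1 : forall t, (Cmod (k t) <= r + Cmod z)%R).
{ intros t. unfold k, Cminus. eapply Rle_trans; [apply Cmod_triangle|].
  rewrite Cmod_opp, Cmod_circle by lra. lra. }
assert (B2 : forall t, (Cmod (dk t) <= r)%R).
{ intros t. unfold dk. rewrite Cmod_mult, Cmod_Ci, Cmod_circle by lra. lra. }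
set (Lb := (r * / (r - Cmod z))%R).
assert (B3 : forall t, (Cmod (kap t) <= Lb)%R).
{ intros t. unfold kap. rewrite Cmod_mult, Cmod_inv by auto. apply Rmult_le_compat; auto;
    try apply Cmod_ge_0.
  - left; apply Rinv_0_lt_compat. apply Cmod_gt_0; auto.
  - apply Rinv_le_contravar; [lra|]. apply Cmod_circle_minus; lra. }
assert (Lb0 : (0 <= Lb)%R) by (eapply Rle_trans; [apply Cmod_ge_0|apply (B3 0%R)]).
assert (FT : forall a b, C_integral dk a b = k b - k a).
{ intros a b. unfold dk, k. rewrite C_integral_dcircle. ring. }
assert (Per : k (2 * PI)%R = k 0%R).
{ unfold k, circle. rewrite sin_2PI, cos_2PI, sin_0, cos_0. reflexivity. }
assert (CF : forall S, continuous_path (fun t => f (z + RtoC (exp S) * k t))).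
{ intros S. apply (holomorphic_continuous_path f (fun t => z + RtoC (exp S) * k t)); auto.
  apply (continuous_path_plus (fun _ => z)); [apply continuous_path_const|].
      apply (continuous_path_mult (fun _ => RtoC (exp S))); [apply continuous_path_const|auto]. }
assert (Inv : forall S, (S <= 0)%R ->
   C_integral (fun t => f (circle r t) * kap t) 0 (2 * PI)
       = C_integral (fun t => f (z + RtoC (exp S) * k t) * kap t) 0 (2 * PI)).
{ intros S HS. pose proof (goursat f k dk z _ _ _ S 0 (2 * PI) Hf Ck Cdk N1 FT B1 B2 B3 HS) as G.
  specialize (G ltac:(pose proof PI_RGT_0; lra)). unfold boundary_integral in G. fold kap in G.
  rewrite Per in G.
  rewrite (C_integral_ext (fun s => f (z + RtoC (exp s) * k 0%R) - f (z + RtoC (exp s) * k 0%R))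
      (fun s => 0 * 0)) in G by (intros; ring).
  rewrite (C_integral_mult 0 (fun _ => 0)) in G by apply continuous_path_const.
  rewrite exp_0 in G.
  rewrite (C_integral_ext _ (fun t => f (circle r t) * kap t - f (z + RtoC (exp S) * k t) * kap t)) in G.
  2: { intros t. unfold k at 1. replace (z + RtoC 1 * (circle r t - z)) with (circle r t)
      by ring. unfold kap; ring. }
  rewrite (C_integral_minus (fun t => f (circle r t) * kap t)
      (fun t => f (z + RtoC (exp S) * k t) * kap t)) in G.
  - apply Ceq_minus. rewrite <- G. ring.
  - apply continuous_path_mult; [apply holomorphic_continuous_path;
      [auto|apply continuous_path_circle]|auto].
  - apply (continuous_path_mult (fun t => f (z + RtoC (exp S) * k t))); auto. }
assert (Lim : C_integral (fun t => f (circle r t) * kap t) 0 (2 * PI) = f z * C_integral kap 0 (2 * PI)).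
{ apply Ceq_minus, Cmod_eq_0. apply Rle_antisym; [|apply Cmod_ge_0].
  apply le_epsilon. intros eps He. rewrite Rplus_0_l.
  pose proof PI_RGT_0 as HPI.
  set (A := (2 * PI * Lb + 1)%R). assert (HA : (0 < A)%R) by (unfold A; nra).
  destruct (Hf z) as [l Hl]. pose proof (has_deriv_C_continuous _ _ _ Hl) as Hc.
      rewrite C_continuous_eps in Hc.
  destruct (Hc (eps / A)%R) as [del [Hd HD]]; [apply Rdiv_lt_0_compat; lra|].
  set (S := Rmin 0 (ln (del / (r + Cmod z + 1)))).
  assert (HS : (exp S <= del / (r + Cmod z + 1))%R).
  { rewrite <- (exp_ln (del / (r + Cmod z + 1))) by (apply Rdiv_lt_0_compat; lra).
    assert (L : (S <= ln (del / (r + Cmod z + 1)))%R) by apply Rmin_r.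
    destruct L as [L| ->]; [left; apply exp_increasing; auto|lra]. }
  rewrite (Inv S) by apply Rmin_l.
  rewrite <- C_integral_mult by auto.
  rewrite <- (C_integral_minus (fun t => f (z + RtoC (exp S) * k t) * kap t) (fun t => f z * kap t)).
  2: { apply (continuous_path_mult (fun t => f (z + RtoC (exp S) * k t))); auto. }
  2: { apply (continuous_path_mult (fun t => f z)); auto. apply continuous_path_const. }
  eapply Rle_trans.
  - apply (C_integral_bound _ 0 (2 * PI) (eps / A * Lb)); [| lra |].
    + apply continuous_path_minus;
        [apply (continuous_path_mult (fun t => f (z + RtoC (exp S) * k t))); auto|].
      apply (continuous_path_mult (fun t => f z)); auto. apply continuous_path_const.
    + intros t _. replace (f (z + RtoC (exp S) * k t) * kap t - f z * kap t)
        with ((f (z + RtoC (exp S) * k t) - f z) * kap t) by ring.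
      rewrite Cmod_mult. apply Rmult_le_compat; auto; try apply Cmod_ge_0. left. apply HD.
      replace (z + RtoC (exp S) * k t - z) with (RtoC (exp S) * k t) by ring.
      rewrite Cmod_mult, Cmod_R, Rabs_pos_eq by (left; apply exp_pos).
      apply Rle_lt_trans with (del / (r + Cmod z + 1) * (r + Cmod z))%R.
      * apply Rmult_le_compat; auto; [left; apply exp_pos|apply Cmod_ge_0].
      * apply Rmult_lt_reg_r with (r + Cmod z + 1)%R; [lra|].
        replace (del / (r + Cmod z + 1)
            * (r + Cmod z) * (r + Cmod z + 1))%R with (del * (r + Cmod z))%R by (field; lra). nra.
  - apply Rmult_le_reg_r with A; [auto|].
    replace ((2 * PI - 0) * (eps / A * Lb) * A)%R with (2 * PI * Lb * eps)%R by (field; lra).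
    unfold A; nra. }
assert (Ek : forall t, kap t = Ci * (circle r t * / (circle r t - z))) by (intros; unfold kap,
    dk, k; ring).
assert (C1 : continuous_path (fun t => circle r t * / (circle r t - z))).
{ apply continuous_path_mult; [apply continuous_path_circle|]. apply (continuous_path_inv k); auto. }
rewrite (C_integral_ext kap _ _ _ Ek) in Lim. rewrite C_integral_mult, C_integral_kernel in Lim by auto.
rewrite (C_integral_ext _ (fun t => Ci * (f (circle r t) * (circle r t * / (circle r t - z))))) in Lim.
2: { intros t. rewrite Ek. ring. }
rewrite (C_integral_mult Ci (fun t => f (circle r t) * (circle r t * / (circle r t - z)))) in Lim.
2: { apply (continuous_path_mult (fun t => f (circle r t))); [apply holomorphic_continuous_path;
    [auto|apply continuous_path_circle]|auto]. }
apply Cmult_cancel_l with Ci; [apply Ci_nz|]. rewrite Lim. ring.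
Qed.

(** The rate [K / 2 ^ M] encodes uniform convergence on the disc together with
    absolute convergence, without infinite sums. *)
Definition expands_on (f : C -> C) (a : nat -> C) (rho : R) : Prop :=
  exists K : R, forall (M : nat) (z : C), (Cmod z <= rho)%R ->
    (Cmod (f z - csum (fun n => (a n * z ^ n)%C) M) <= K / 2 ^ M)%R.

Lemma taylor_disc f r : holomorphic f -> (0 < r)%R -> exists a, expands_on f a (r / 2).
Proof.
intros Hf Hr. pose proof PI_RGT_0 as HPI.
assert (Cf : continuous_path (fun t => f (circle r t))) by (apply holomorphic_continuous_path;
    [auto|apply continuous_path_circle]).
assert (HB : exists B, forall t, (Cmod (f (circle r t)) <= B)%R).
{ destruct (continuity_ab_maj (fun t => Cmod (f (circle r t))) 0 (2 * PI)) as [x [Hx _]]; [lra| |].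
  - intros c _. apply continuity_pt_filterlim.
      apply (proj2 (filterlim_locally (U := R_UniformSpace) _ _)).
    intros eps. pose proof (proj1 (filterlim_locally (U := CU) _ _) (Cf c) eps) as H.
    destruct H as [d Hd]. exists d. intros y Hy. specialize (Hd y Hy).
    change (Rabs (Cmod (f (circle r y)) - Cmod (f (circle r c))) < eps)%R.
    eapply Rle_lt_trans; [|exact Hd].
    pose proof (Cmod_triangle (f (circle r y) - f (circle r c)) (f (circle r c))) as T1.
    pose proof (Cmod_triangle (f (circle r c) - f (circle r y)) (f (circle r y))) as T2.
    replace (f (circle r y) - f (circle r c) + f (circle r c)) with (f (circle r y)) in T1 by ring.
    replace (f (circle r c) - f (circle r y) + f (circle r y)) with (f (circle r c)) in T2 by ring.
    rewrite <- (Cmod_opp (f (circle r c) - f (circle r y))) in T2.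
    replace (- (f (circle r c) - f (circle r y))) with (f (circle r y) - f (circle r c)) in T2 by ring.
    change (Rabs (Cmod (f (circle r y)) - Cmod (f (circle r c)))
        <= Cmod (f (circle r y) - f (circle r c)))%R.
    apply Rabs_le. lra.
  - exists (Cmod (f (circle r x))). intros t.
    (* the maximum was taken over one period; [t] is congruent to [t'] in it *)
    set (m := Int_part (t / (2 * PI))).
    destruct (base_Int_part (t / (2 * PI))) as [I1 I2]. fold m in I1, I2.
    set (t' := (t - IZR m * (2 * PI))%R).
    assert (Ht' : (0 <= t' <= 2 * PI)%R).
    { assert (E : t = (t / (2 * PI) * (2 * PI))%R) by (field; lra).
      unfold t'. split; [|]; rewrite E at 1; nra. }
    replace (circle r t) with (circle r t'); [exact (Hx t' Ht')|].
    assert (P : forall n y, circle r (y + 2 * INR n * PI) = circle r y).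
    { intros n y. unfold circle. rewrite sin_period, cos_period. reflexivity. }
    destruct (Z.le_gt_cases 0 m) as [L|L].
    + rewrite <- (P (Z.to_nat m) t'). f_equal. unfold t'.
      rewrite INR_IZR_INZ, Z2Nat.id by lia. ring.
    + rewrite <- (P (Z.to_nat (- m)) t). f_equal. unfold t'.
      rewrite INR_IZR_INZ, Z2Nat.id, opp_IZR by lia. ring. }
destruct HB as [B HB].
exists (fun n => RtoC (/ (2 * PI)) * C_integral (fun t => f (circle r t) * (/ circle r t) ^ n)
    0 (2 * PI)).
exists (B * 2)%R. intros M z Hz. pose proof (Cmod_ge_0 z) as Z0.
assert (Hzr : (Cmod z < r)%R) by lra.
assert (B0 : (0 <= B)%R) by (eapply Rle_trans; [apply Cmod_ge_0|apply (HB 0%R)]).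
pose proof (kernel_expansion r z (fun t => f (circle r t)) B M Hzr Cf HB) as K. cbv beta in K.
rewrite cauchy in K by auto.
assert (P0 : RtoC (2 * PI) <> 0) by (intros E; apply RtoC_inj in E; lra).
match goal with |- (Cmod ?x <= _)%R => replace x with (RtoC (/ (2 * PI)) * (RtoC (2 * PI) * f z -
  csum (fun n => C_integral (fun t => f (circle r t) * (/ circle r t) ^ n) 0 (2 * PI) * z ^ n) M)) end.
2: { assert (Hc : RtoC (/ (2 * PI)) * RtoC (2 * PI) = 1) by (rewrite <- RtoC_mult; f_equal; field; lra).
     rewrite (csum_ext (fun n => RtoC (/ (2 * PI))
         * C_integral (fun t => f (circle r t) * (/ circle r t) ^ n) 0 (2 * PI) * z ^ n)
       (fun n => RtoC (/ (2 * PI)) * (C_integral (fun t => f (circle r t) * (/ circle r t) ^ n)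
           0 (2 * PI) * z ^ n)))
       by (intros; ring).
     rewrite <- csum_mult. set (c := RtoC (/ (2 * PI))) in *. set (p := RtoC (2 * PI)) in *.
     set (w := csum _ M). transitivity (c * p * f z - c * w); [ring|rewrite Hc; ring]. }
rewrite Cmod_mult, Cmod_R, Rabs_pos_eq by (left; apply Rinv_0_lt_compat; lra).
apply Rmult_le_compat_l with (r := (/ (2 * PI))%R) in K; [|left; apply Rinv_0_lt_compat; lra].
eapply Rle_trans; [exact K|].
replace (/ (2 * PI) * (2 * PI * (B * ((Cmod z / r) ^ M * (r / (r - Cmod z))))))%R
  with (B * ((Cmod z / r) ^ M * (r / (r - Cmod z))))%R by (field; lra).
unfold Rdiv at 3. rewrite Rmult_assoc. apply Rmult_le_compat_l; [auto|].
rewrite Rmult_comm. apply Rmult_le_compat.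
- apply Rmult_le_pos; [lra|left; apply Rinv_0_lt_compat; lra].
- apply pow_le. apply Rmult_le_pos; [lra|left; apply Rinv_0_lt_compat; lra].
- apply Rmult_le_reg_r with (r - Cmod z)%R; [lra|]. unfold Rdiv; rewrite Rmult_assoc, Rinv_l; lra.
- rewrite <- pow_inv. apply pow_incr. split; [apply Rmult_le_pos; [lra|left;
    apply Rinv_0_lt_compat; lra]|].
  apply Rmult_le_reg_r with r; [lra|]. unfold Rdiv; rewrite Rmult_assoc, Rinv_l; lra.
Qed.

(** * Means over roots of unity *)

Fixpoint rsum (u : nat -> R) (n : nat) : R :=
  match n with O => 0%R | S m => (rsum u m + u m)%R end.

Lemma rsum_le u v n : (forall j, (j < n)%nat -> (u j <= v j)%R) -> (rsum u n <= rsum v n)%R.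
Proof.
induction n as [|n IH]; intros H; simpl; [lra|].
apply Rplus_le_compat; [apply IH; intros; apply H; lia|apply H; lia].
Qed.

Lemma rsum_const c n : rsum (fun _ => c) n = (INR n * c)%R.
Proof. induction n as [|n IH]; [simpl; ring|]. rewrite S_INR; simpl rsum. rewrite IH. ring. Qed.

Lemma rsum_mult c u n : rsum (fun j => (c * u j)%R) n = (c * rsum u n)%R.
Proof. induction n as [|n IH]; simpl; [ring|rewrite IH; ring]. Qed.

Lemma csum_plus u v n : csum (fun j => u j + v j) n = csum u n + csum v n.
Proof. induction n as [|n IH]; simpl; [ring|rewrite IH; ring]. Qed.

Lemma Cmod_csum u n : (Cmod (csum u n) <= rsum (fun j => Cmod (u j)) n)%R.
Proof.
induction n as [|n IH]; simpl; [rewrite Cmod_0; lra|].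
eapply Rle_trans; [apply Cmod_triangle|]. lra.
Qed.

Lemma Re_csum u n : Re (csum u n) = rsum (fun j => Re (u j)) n.
Proof. induction n as [|n IH]; [reflexivity|]. simpl csum. rewrite re_plus, IH. reflexivity. Qed.

Lemma csum_conj u n : Cconj (csum u n) = csum (fun j => Cconj (u j)) n.
Proof.
induction n as [|n IH]; simpl; [apply injective_projections; simpl; ring|].
rewrite Cplus_conj, IH. reflexivity.
Qed.

Lemma Cmod_csum_const u n M : (forall j, (j < n)%nat -> (Cmod (u j) <= M)%R) ->
  (Cmod (csum u n) <= INR n * M)%R.
Proof.
intros H. eapply Rle_trans; [apply Cmod_csum|]. rewrite <- rsum_const. apply rsum_le; auto.
Qed.

Lemma csum_geom w n : (w - 1) * csum (fun j => w ^ j) n = w ^ n - 1.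
Proof.
induction n as [|n IH]; [simpl; ring|]. simpl csum. rewrite Cmult_plus_distr_l, IH, Cpow_S. ring.
Qed.

Definition unity_root (N : nat) : C := circle 1 (2 * PI / INR N).

Lemma circle1_pow t n : circle 1 t ^ n = circle 1 (INR n * t).
Proof.
induction n as [|n IH].
- unfold circle. simpl. rewrite Rmult_0_l, cos_0, sin_0. apply injective_projections; simpl; ring.
- rewrite Cpow_S, IH, S_INR. unfold circle.
  replace ((INR n + 1) * t)%R with (INR n * t + t)%R by ring. rewrite cos_plus, sin_plus.
  apply injective_projections; simpl; ring.
Qed.

Lemma Cmod_unity_root N : Cmod (unity_root N) = 1.
Proof. apply Cmod_circle; lra. Qed.

Lemma Cmod_unity_root_pow N j : Cmod (unity_root N ^ j) = 1.
Proof. rewrite Cmod_pow, Cmod_unity_root. apply pow1. Qed.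

Lemma unity_root_pow_N N : (0 < N)%nat -> unity_root N ^ N = 1.
Proof.
intros H. unfold unity_root. rewrite circle1_pow.
assert (INR N <> 0)%R by (apply not_0_INR; lia).
replace (INR N * (2 * PI / INR N))%R with (2 * PI)%R by (field; auto).
unfold circle. rewrite cos_2PI, sin_2PI. apply injective_projections; simpl; ring.
Qed.

Lemma unity_root_pow_neq_1 N p : (0 < p < N)%nat -> unity_root N ^ p <> 1.
Proof.
intros H E. unfold unity_root in E. rewrite circle1_pow in E.
assert (HN : (0 < INR N)%R) by (apply lt_0_INR; lia).
assert (Hp : (0 < INR p)%R) by (apply lt_0_INR; lia).
assert (Hq : (INR p < INR N)%R) by (apply lt_INR; lia).
set (h := (INR p * PI / INR N)%R).
replace (INR p * (2 * PI / INR N))%R with (2 * h)%R in E by (unfold h; field; lra).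
pose proof (f_equal fst E) as E1. simpl in E1. rewrite Rmult_1_l, cos_2a_sin in E1.
pose proof PI_RGT_0 as HPI.
assert (P : (0 < sin h)%R).
{ apply sin_gt_0; unfold h.
  - apply Rdiv_lt_0_compat; [nra|auto].
  - apply Rmult_lt_reg_r with (INR N); [auto|].
    replace (INR p * PI / INR N * INR N)%R with (INR p * PI)%R by (field; lra). nra. }
nra.
Qed.

Definition mean (N : nat) (u : nat -> C) : C := RtoC (/ INR N) * csum u N.

Lemma mean_plus N u v : mean N (fun j => u j + v j) = mean N u + mean N v.
Proof. unfold mean. rewrite csum_plus. ring. Qed.

Lemma csum_minus u v n : csum (fun j => u j - v j) n = csum u n - csum v n.
Proof. induction n as [|n IH]; simpl; [ring|rewrite IH; ring]. Qed.

Lemma mean_minus N u v : mean N (fun j => u j - v j) = mean N u - mean N v.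
Proof. unfold mean. rewrite csum_minus. ring. Qed.

Lemma Cmult_minus_distr_r' (x y z : C) : (x - y) * z = x * z - y * z.
Proof. ring. Qed.

Lemma mean_mult N c u : mean N (fun j => c * u j) = c * mean N u.
Proof. unfold mean. rewrite <- csum_mult. ring. Qed.

Lemma mean_ext N u v : (forall j, u j = v j) -> mean N u = mean N v.
Proof. intros H. unfold mean. f_equal. apply csum_ext; auto. Qed.

Lemma Cmod_mean N u M : (0 < N)%nat -> (forall j, (Cmod (u j) <= M)%R) -> (Cmod (mean N u) <= M)%R.
Proof.
intros HN H. unfold mean. assert (P : (0 < INR N)%R) by (apply lt_0_INR; lia).
rewrite Cmod_mult, Cmod_R, Rabs_pos_eq by (left; apply Rinv_0_lt_compat; lra).
apply Rmult_le_reg_l with (INR N); [auto|]. rewrite <- Rmult_assoc, Rinv_r, Rmult_1_l by lra.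
apply Cmod_csum_const. auto.
Qed.

Lemma mean_const_1 N : (0 < N)%nat -> mean N (fun _ => 1) = 1.
Proof.
intros H. unfold mean. assert (E : csum (fun _ => 1) N = RtoC (INR N)).
{ clear. induction N as [|N IH]; [reflexivity|]. rewrite S_INR, RtoC_plus, <- IH. reflexivity. }
rewrite E, <- RtoC_mult, Rinv_l by (apply not_0_INR; lia). reflexivity.
Qed.

(** Orthogonality of characters; the range of [p] is the one met when the
    exponent [N - m] plays the role of [- m]. *)
Lemma mean_unity_root N p : (0 < p < 2 * N)%nat -> mean N (fun j => (unity_root N ^ j) ^ p)
    = if Nat.eq_dec p N then 1 else 0.
Proof.
intros H. assert (HN : (0 < N)%nat) by lia.
rewrite (mean_ext _ _ (fun j => (unity_root N ^ p) ^ j)).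
2: { intros j. rewrite <- !Cpow_mult_r. f_equal. lia. }
destruct (Nat.eq_dec p N) as [->|Hp].
- rewrite unity_root_pow_N by auto. rewrite (mean_ext _ _ (fun _ => 1)) by (intros; apply Cpow_1_l).
  apply mean_const_1; auto.
- assert (Hw : unity_root N ^ p <> 1).
  { destruct (Nat.lt_ge_cases p N) as [L|L]; [apply unity_root_pow_neq_1; lia|].
    replace p with (N + (p - N))%nat by lia. rewrite Cpow_add_r, unity_root_pow_N, Cmult_1_l by auto.
    apply unity_root_pow_neq_1; lia. }
  unfold mean. replace (csum (fun j => (unity_root N ^ p) ^ j) N) with (RtoC 0); [ring|].
  apply Cmult_cancel_l with (unity_root N ^ p - 1).
  + intros E. apply Hw. apply Ceq_minus. exact E.
  + rewrite csum_geom, <- Cpow_mult_r, Nat.mul_comm, Cpow_mult_r, unity_root_pow_N,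
      Cpow_1_l by auto. ring.
Qed.

Lemma mean_poly N (a : nat -> C) z l M :
  mean N (fun j => csum (fun n => a n * (z * unity_root N ^ j) ^ n) M * (unity_root N ^ j) ^ l)
  = csum (fun n => a n * z ^ n * mean N (fun j => (unity_root N ^ j) ^ (n + l))) M.
Proof.
induction M as [|M IH]; simpl csum.
- rewrite (mean_ext _ _ (fun _ => 0 * 0)) by (intros; ring). rewrite mean_mult. ring.
- rewrite <- IH, <- mean_mult, <- mean_plus. apply mean_ext. intros j.
  rewrite Cpow_mult_l, Cpow_add_r. ring.
Qed.

Lemma pow2_large K eps : (0 < eps)%R -> exists M0, forall M, (M0 <= M)%nat -> (K / 2 ^ M <= eps)%R.
Proof.
intros He. pose proof (Rabs_pos K) as K0.
destruct (pow_lt_1_zero (/2) ltac:(rewrite Rabs_pos_eq; lra) (eps / (Rabs K + 1))) as [N HN].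
{ apply Rdiv_lt_0_compat; lra. }
exists N. intros M HM. specialize (HN M HM).
rewrite Rabs_pos_eq in HN by (apply pow_le; lra). rewrite pow_inv in HN.
assert (P : (0 < / 2 ^ M)%R) by (apply Rinv_0_lt_compat, pow_lt; lra).
apply Rle_trans with ((Rabs K + 1) * / 2 ^ M)%R.
- apply Rmult_le_compat_r; [lra|]. pose proof (Rle_abs K); lra.
- apply Rmult_lt_compat_l with (r := (Rabs K + 1)%R) in HN; [|lra].
  replace ((Rabs K + 1) * (eps / (Rabs K + 1)))%R with eps in HN by (field; lra). lra.
Qed.

Lemma csum_single (u : nat -> C) m M : (m < M)%nat -> (forall n, (n < M)%nat -> n <> m -> u n = 0) ->
  csum u M = u m.
Proof.
intros Hm. induction M as [|M IH]; [lia|]. intros H. simpl.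
destruct (Nat.eq_dec m M) as [->|N].
- replace (csum u M) with (RtoC 0); [ring|].
  rewrite (csum_ext u (fun _ => 0 * 0)) by (intros n Hn; rewrite H by lia; ring).
  rewrite <- csum_mult. ring.
- rewrite IH by (try lia; intros; apply H; lia). rewrite (H M) by lia. ring.
Qed.

(** Discrete Fourier coefficients of [f] on a circle: for large [N] the mean
    against the character of index [- m] isolates the coefficient of index [m],
    and the means against positive indices tend to zero, since the expansion has no
    negative powers. The errors come only from the tail of the expansion, because
    the means of a partial sum are exact once [N] exceeds its degree plus [m]. *)
Lemma coef_mean f a rho : expands_on f a rho ->
  forall m eps, (0 < eps)%R -> exists N0, (0 < N0)%nat /\ forall N z,
      (N0 <= N)%nat -> (Cmod z <= rho)%R ->
   (Cmod (mean N (fun j => f (z * unity_root N ^ j) * (unity_root N ^ j)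
       ^ (N - m)) - a m * z ^ m)%C <= eps)%R /\
   ((0 < m)%nat -> (Cmod (mean N (fun j => f (z * unity_root N ^ j) * (unity_root N ^ j)
       ^ m))%C <= eps)%R).
Proof.
intros [K HK] m eps He. destruct (pow2_large K eps He) as [M1 HM1].
set (M := Nat.max (S m) M1). exists (M + m + 1)%nat. split; [lia|]. intros N z HN Hz.
specialize (HM1 M ltac:(lia)).
assert (Z : forall j, (Cmod (z * unity_root N ^ j) <= rho)%R).
{ intros j. rewrite Cmod_mult, Cmod_unity_root_pow, Rmult_1_r. exact Hz. }
assert (E : forall l, (Cmod (mean N (fun j => f (z * unity_root N ^ j) * (unity_root N ^ j) ^ l)
    - csum (fun n => a n * z ^ n * mean N (fun j => (unity_root N ^ j) ^ (n + l))) M)%C <= eps)%R).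
{ intros l. rewrite <- mean_poly, <- mean_minus. apply Cmod_mean; [lia|]. intros j.
  rewrite <- Cmult_minus_distr_r'.
  rewrite Cmod_mult, Cmod_pow, Cmod_unity_root_pow, pow1, Rmult_1_r.
  eapply Rle_trans; [apply HK; auto|exact HM1]. }
split.
- specialize (E (N - m)%nat).
  rewrite (csum_single _ m M) in E.
  + replace (m + (N - m))%nat with N in E by lia. rewrite mean_unity_root in E by lia.
    destruct (Nat.eq_dec N N) as [_|n]; [|lia]. rewrite Cmult_1_r in E. exact E.
  + lia.
  + intros n Hn Hnm. rewrite mean_unity_root by lia. destruct (Nat.eq_dec _ N); [lia|]. ring.
- intros Hm. specialize (E m).
  rewrite (csum_ext _ (fun _ => 0 * 0)) in E.
  + rewrite <- csum_mult in E.
    match type of E with (Cmod (?x - ?y)%C <= _)%R => replace (x - y)%C with x in E by ring end.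
    exact E.
  + intros n Hn. rewrite mean_unity_root by lia. destruct (Nat.eq_dec _ N); [lia|]. ring.
Qed.

Lemma expands_on_unique f a b rho : (0 < rho)%R -> expands_on f a rho -> expands_on f b rho ->
    forall n, a n = b n.
Proof.
intros Hr Ha Hb m.
assert (P : (RtoC rho) ^ m <> 0) by (apply Cpow_nz; intros E; apply RtoC_inj in E; lra).
apply Cmult_cancel_l with (RtoC rho ^ m); [auto|].
apply Ceq_minus, Cmod_eq_0. apply Rle_antisym; [|apply Cmod_ge_0].
apply le_epsilon. intros eps He. rewrite Rplus_0_l.
destruct (coef_mean f a rho Ha m (eps/2)%R ltac:(lra)) as [N1 [H1 A1]].
destruct (coef_mean f b rho Hb m (eps/2)%R ltac:(lra)) as [N2 [H2 A2]].
set (N := Nat.max N1 N2).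
assert (Hz : (Cmod (RtoC rho) <= rho)%R) by (rewrite Cmod_R, Rabs_pos_eq; lra).
destruct (A1 N (RtoC rho) ltac:(lia) Hz) as [B1 _]. destruct (A2 N (RtoC rho) ltac:(lia) Hz) as [B2 _].
set (x := mean N _) in *.
replace (RtoC rho ^ m * a m - RtoC rho ^ m * b m) with
  (- (x - a m * RtoC rho ^ m) + (x - b m * RtoC rho ^ m)) by ring.
eapply Rle_trans; [apply Cmod_triangle|]. rewrite Cmod_opp. lra.
Qed.

Definition expands (f : C -> C) (a : nat -> C) : Prop := forall rho : R, expands_on f a rho.

Lemma expands_on_mono f a r r' : (r <= r')%R -> expands_on f a r' -> expands_on f a r.
Proof. intros H [K HK]. exists K. intros M z Hz. apply HK; lra. Qed.

(** Each disc gives its own coefficients; they agree since the coefficients of an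
    expansion are determined by the function on any smaller disc. *)
Theorem holomorphic_expands f : holomorphic f -> exists a, expands f a.
Proof.
intros Hf. destruct (taylor_disc f 2 Hf ltac:(lra)) as [a Ha]. exists a. intros rho.
set (r := Rmax 1 rho). assert (1 <= r /\ rho <= r)%R by (split; [apply Rmax_l|apply Rmax_r]).
destruct (taylor_disc f (2 * r) Hf ltac:(lra)) as [b Hb].
apply (expands_on_mono f a rho r); [lra|].
replace (2 * r / 2)%R with r in Hb by field.
replace a with b; [exact Hb|]. apply functional_extensionality.
apply (expands_on_unique f b a 1); [lra| |].
- apply (expands_on_mono f b 1 r); [lra|auto].
- apply (expands_on_mono f a 1 (2/2)); [lra|auto].
Qed.

(** * Calculus of everywhere convergent power series *)

Lemma Cmod_le_abs (z : C) : (Cmod z <= Rabs (fst z) + Rabs (snd z))%R.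
Proof.
replace z with (RtoC (fst z) + Ci * RtoC (snd z)) at 1 by (apply injective_projections; simpl; ring).
eapply Rle_trans; [apply Cmod_triangle|]. rewrite Cmod_mult, Cmod_Ci, !Cmod_R. lra.
Qed.

Definition seq_lim (u : nat -> C) (l : C) : Prop :=
  forall eps, (0 < eps)%R -> exists M0, forall M, (M0 <= M)%nat -> (Cmod (l - u M) <= eps)%R.

Lemma C_complete_geometric u K : (forall M M', (M <= M')%nat -> (Cmod (u M' - u M) <= K / 2 ^ M)%R) ->
  exists l, seq_lim u l.
Proof.
intros H.
assert (A : forall g : C -> R, (forall x y, Rabs (g x - g y) <= Cmod (x - y))%R ->
   exists l, Un_cv (fun n => g (u n)) l).
{ intros g Hg. destruct (Rcomplete.R_complete (fun n => g (u n))) as [l Hl]; [|exists l; exact Hl].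
  intros eps He. destruct (pow2_large K (eps / 2)%R ltac:(lra)) as [M0 HM].
  assert (D : forall n m, (M0 <= n)%nat -> (n <= m)%nat -> (Rabs (g (u m) - g (u n)) < eps)%R).
  { intros n m Hn Hm. eapply Rle_lt_trans; [apply Hg|]. eapply Rle_lt_trans; [apply H; auto|].
    eapply Rle_lt_trans; [apply HM; auto|]. lra. }
  exists M0. intros n m Hn Hm. unfold Rdist. destruct (Nat.le_ge_cases n m).
  - rewrite Rabs_minus_sym. apply D; auto.
  - apply D; auto. }
destruct (A fst) as [l1 H1].
{ intros x y. exact (Rle_trans _ _ _ (Rmax_l _ _) (Rmax_Cmod (x - y))). }
destruct (A snd) as [l2 H2].
{ intros x y. exact (Rle_trans _ _ _ (Rmax_r _ _) (Rmax_Cmod (x - y))). }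
exists (l1, l2). intros eps He.
destruct (H1 (eps / 2)%R ltac:(lra)) as [N1 K1]. destruct (H2 (eps / 2)%R ltac:(lra)) as [N2 K2].
exists (Nat.max N1 N2). intros M HM.
specialize (K1 M ltac:(lia)). specialize (K2 M ltac:(lia)). unfold Rdist in K1, K2.
eapply Rle_trans; [apply Cmod_le_abs|]. simpl.
rewrite <- Rabs_Ropp in K1, K2.
replace (- (fst (u M) - l1))%R with (l1 + - fst (u M))%R in K1 by ring.
replace (- (snd (u M) - l2))%R with (l2 + - snd (u M))%R in K2 by ring. lra.
Qed.

Lemma seq_lim_bound u l c B M0 : seq_lim u l -> (forall M, (M0 <= M)%nat -> (Cmod (u M - c) <= B)%R) ->
  (Cmod (l - c) <= B)%R.
Proof.
intros Hl H. apply le_epsilon. intros eps He. destruct (Hl eps He) as [M1 H1].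
replace (l - c) with ((l - u (Nat.max M0 M1)) + (u (Nat.max M0 M1) - c)) by ring.
eapply Rle_trans; [apply Cmod_triangle|].
specialize (H (Nat.max M0 M1) ltac:(lia)). specialize (H1 (Nat.max M0 M1) ltac:(lia)). lra.
Qed.

(** Coefficients of everywhere convergent power series, by Cauchy's estimates. *)
Definition entire_coef (a : nat -> C) : Prop :=
  forall R, (0 <= R)%R -> exists A, forall n, (Cmod (a n) * R ^ n <= A)%R.

Lemma pow2_pos n : (0 < 2 ^ n)%R.
Proof. apply pow_lt; lra. Qed.

Lemma INR_S_le_pow2 n : (INR (S n) <= 2 ^ S n)%R.
Proof.
induction n as [|n IH]; [simpl; lra|].
rewrite S_INR. change (2 ^ S (S n))%R with (2 * 2 ^ S n)%R.
assert (1 <= 2 ^ S n)%R by (apply pow_R1_Rle; lra). lra.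
Qed.

Lemma expands_entire_coef f a : expands f a -> entire_coef a.
Proof.
intros H R HR. destruct (H R) as [K HK]. exists (2 * Rabs K)%R. intros n.
replace (Cmod (a n) * R ^ n)%R with (Cmod (a n * RtoC R ^ n)).
2: { rewrite Cmod_mult, Cmod_pow, Cmod_R, (Rabs_pos_eq R) by auto. reflexivity. }
assert (HR' : (Cmod (RtoC R) <= R)%R) by (rewrite Cmod_R, Rabs_pos_eq; lra).
pose proof (HK n _ HR') as A1. pose proof (HK (S n) _ HR') as A2. simpl csum in A2.
assert (B : forall m, (K / 2 ^ m <= Rabs K)%R).
{ intros m. apply Rle_trans with (Rabs K * / 2 ^ m)%R.
  - apply Rmult_le_compat_r; [left; apply Rinv_0_lt_compat, pow2_pos|apply Rle_abs].
  - rewrite <- (Rmult_1_r (Rabs K)) at 2. apply Rmult_le_compat_l; [apply Rabs_pos|].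
    rewrite <- Rinv_1. apply Rinv_le_contravar; [lra|]. apply pow_R1_Rle; lra. }
pose proof (B n). pose proof (B (S n)).
set (s := csum _ n) in *.
replace (a n * RtoC R ^ n) with ((f (RtoC R) - s) + - (f (RtoC R) - (s + a n * RtoC R ^ n))) by ring.
eapply Rle_trans; [apply Cmod_triangle|]. rewrite Cmod_opp. lra.
Qed.

Lemma tail_bound (v : nat -> C) A :
  (forall n, (Cmod (v n) <= A / 2 ^ n)%R) ->
  forall M M', (M <= M')%nat -> (Cmod (csum v M' - csum v M) <= 2 * A / 2 ^ M)%R.
Proof.
intros H M M' HM.
assert (A0 : (0 <= A)%R).
{ pose proof (Cmod_ge_0 (v O)) as V0. pose proof (H O) as V1. simpl in V1. lra. }
assert (E : (Cmod (csum v M' - csum v M) <= 2 * A / 2 ^ M - 2 * A / 2 ^ M')%R).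
{ induction HM as [|m HM IH].
  - replace (csum v M - csum v M) with (RtoC 0) by ring. rewrite Cmod_0. lra.
  - simpl csum. replace (csum v m + v m - csum v M) with ((csum v m - csum v M) + v m) by ring.
    eapply Rle_trans; [apply Cmod_triangle|]. specialize (H m). pose proof (pow2_pos m).
    replace (2 * A / 2 ^ S m)%R with (A / 2 ^ m)%R by (simpl; field; lra).
    replace (2 * A / 2 ^ m)%R with (A / 2 ^ m + A / 2 ^ m)%R in IH by (field; lra). lra. }
assert (0 <= 2 * A / 2 ^ M')%R by (apply Rmult_le_pos; [lra|left; apply Rinv_0_lt_compat, pow2_pos]).
lra.
Qed.

Lemma entire_coef_expands a : entire_coef a -> exists f, expands f a.
Proof.
intros Ha.
assert (T : forall rho, exists K, forall z, (Cmod z <= rho)%R -> forall M M', (M <= M')%nat ->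
   (Cmod (csum (fun n => a n * z ^ n) M' - csum (fun n => a n * z ^ n) M)%C <= K / 2 ^ M)%R).
{ intros rho. destruct (Ha (2 * Rabs rho)%R) as [A HA]; [pose proof (Rabs_pos rho); lra|].
  exists (2 * A)%R. intros z Hz. apply tail_bound. intros n.
  apply Rmult_le_reg_r with (2 ^ n)%R; [apply pow2_pos|].
  unfold Rdiv; rewrite Rmult_assoc, Rinv_l, Rmult_1_r by (apply Rgt_not_eq, pow2_pos).
  eapply Rle_trans; [|apply (HA n)]. rewrite Cmod_mult, Cmod_pow, Rpow_mult_distr, Rmult_assoc.
  apply Rmult_le_compat_l; [apply Cmod_ge_0|]. rewrite Rmult_comm.
  apply Rmult_le_compat_l; [left; apply pow2_pos|]. apply pow_incr. split; [apply Cmod_ge_0|].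
  pose proof (Rle_abs rho); lra. }
assert (L : forall z, exists l, seq_lim (fun M => csum (fun n => a n * z ^ n) M) l).
{ intros z. destruct (T (Cmod z)) as [K HK]. apply (C_complete_geometric _ K). intros M M' HM.
  apply HK; [lra|auto]. }
exists (fun z => proj1_sig (constructive_indefinite_description _ (L z))).
intros rho. destruct (T rho) as [K HK]. exists K. intros M z Hz.
destruct (constructive_indefinite_description _ (L z)) as [l Hl]. simpl.
apply (seq_lim_bound _ _ _ _ M Hl). intros M' HM. apply HK; auto.
Qed.

Lemma expands_seq_lim f a z : expands f a -> seq_lim (fun M => csum (fun n => a n * z ^ n) M) (f z).
Proof.
intros H eps He. destruct (H (Cmod z)) as [K HK]. destruct (pow2_large K eps He) as [M0 HM].
exists M0. intros M HMM. eapply Rle_trans; [apply HK; lra|apply HM; auto].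
Qed.

Lemma monomial_taylor rho z w n : (1 <= rho)%R -> (Cmod z <= rho)%R -> (Cmod w <= rho)%R ->
  (Cmod (w ^ n - z ^ n - RtoC (INR n) * z ^ (pred n) * (w - z))
    <= Cmod (w - z) * Cmod (w - z) * (2 * rho) ^ n)%R.
Proof.
intros Hr Hz Hw. set (d := Cmod (w - z)). assert (d0 : (0 <= d)%R) by apply Cmod_ge_0.
assert (d2 : (0 <= d * d)%R) by (apply Rmult_le_pos; auto).
induction n as [|n IH].
- simpl. replace (1 - 1 - RtoC 0 * 1 * (w - z)) with (RtoC 0) by ring. rewrite Cmod_0. lra.
- destruct n as [|n].
  + simpl. replace (w * 1 - z * 1 - RtoC 1 * 1 * (w - z)) with (RtoC 0) by ring. rewrite Cmod_0.
    apply Rmult_le_pos; [auto|lra].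
  + simpl pred in *.
    replace (w ^ S (S n) - z ^ S (S n) - RtoC (INR (S (S n))) * z ^ S n * (w - z))
      with (w * (w ^ S n - z ^ S n - RtoC (INR (S n)) * z ^ n * (w - z))
            + RtoC (INR (S n)) * z ^ n * ((w - z) * (w - z))).
    2: { rewrite (S_INR (S n)), RtoC_plus, !Cpow_S. ring. }
    eapply Rle_trans; [apply Cmod_triangle|]. rewrite !Cmod_mult, Cmod_pow, Cmod_R. fold d.
    rewrite (Rabs_pos_eq (INR (S n))) by apply pos_INR.
    pose proof (INR_S_le_pow2 n) as I1.
    assert (I2 : (Cmod z ^ n <= rho ^ S n)%R).
    { apply Rle_trans with (rho ^ n)%R; [apply pow_incr; split; [apply Cmod_ge_0|auto]|].
      apply Rle_pow; [auto|lia]. }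
    assert (I3 : (INR (S n) * Cmod z ^ n <= (2 * rho) ^ S n)%R).
    { rewrite Rpow_mult_distr. apply Rmult_le_compat; auto; [apply pos_INR|apply pow_le, Cmod_ge_0]. }
    assert (P : (0 <= (2 * rho) ^ S n)%R) by (apply pow_le; lra).
    assert (I4 : (Cmod w * Cmod (w ^ S n - z ^ S n - RtoC (INR (S n)) * z ^ n * (w - z))
        <= rho * (d * d * (2 * rho) ^ S n))%R).
    { apply Rmult_le_compat; auto; apply Cmod_ge_0. }
    assert (I5 : (INR (S n) * Cmod z ^ n * (d * d) <= (2 * rho) ^ S n * (d * d))%R)
        by (apply Rmult_le_compat_r; auto).
    change ((2 * rho) ^ S (S n))%R with (2 * rho * (2 * rho) ^ S n)%R.
    assert (0 <= d * d * (2 * rho) ^ S n)%R by (apply Rmult_le_pos; auto).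
    nra.
Qed.

Definition deriv_coef (a : nat -> C) (n : nat) : C := RtoC (INR (S n)) * a (S n).

Lemma csum_deriv_coef a z M :
  csum (fun n => deriv_coef a n * z ^ n) M = csum (fun n => a n * (RtoC (INR n) * z ^ pred n)) (S M).
Proof.
induction M as [|M IH]; [simpl; ring|].
change (csum ?u (S (S M))) with (csum u (S M) + u (S M)). rewrite <- IH. simpl csum.
unfold deriv_coef. simpl pred. ring.
Qed.

(** Termwise differentiation: the second-order remainders of the partial sums are
    bounded by [2 * A * |w - z| ^ 2] uniformly in the order of the sum, so the bound
    passes to the limit. *)
Lemma deriv_expands F f b : expands F b -> expands f (deriv_coef b) -> forall z, has_deriv F z (f z).
Proof.
intros HF Hf z. set (rho := (Cmod z + 1)%R). pose proof (Cmod_ge_0 z) as Z0.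
destruct (expands_entire_coef F b HF (2 * (2 * rho))%R) as [A HA]; [unfold rho; lra|].
assert (A0 : (0 <= A)%R).
{ specialize (HA O). pose proof (Cmod_ge_0 (b O)). simpl in HA. lra. }
assert (Q : forall w, (Cmod w <= rho)%R -> (Cmod (F w - F z - f z * (w - z))
    <= 2 * A * (Cmod (w - z) * Cmod (w - z)))%R).
{ intros w Hw. replace (F w - F z - f z * (w - z)) with (F w - F z - f z * (w - z) - 0) by ring.
  apply (seq_lim_bound (fun M => csum (fun n => b n * w ^ n) (S M) - csum (fun n => b n * z ^ n) (S M)
     - csum (fun n => deriv_coef b n * z ^ n) M * (w - z)) _ _ _ O).
  - intros eps He. set (e := (eps / (2 + Cmod (w - z)))%R). pose proof (Cmod_ge_0 (w - z)) as D0.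
    assert (e0 : (0 < e)%R) by (apply Rdiv_lt_0_compat; lra).
    destruct (expands_seq_lim F b w HF e e0) as [M1 H1].
    destruct (expands_seq_lim F b z HF e e0) as [M2 H2].
    destruct (expands_seq_lim f (deriv_coef b) z Hf e e0) as [M3 H3].
    exists (M1 + M2 + M3)%nat. intros M HM.
    specialize (H1 (S M) ltac:(lia)). specialize (H2 (S M) ltac:(lia)).
        specialize (H3 M ltac:(lia)). cbv beta in H1, H2, H3.
    set (p := csum (fun n => b n * w ^ n) (S M)) in *. set (q := csum (fun n => b n * z ^ n) (S M)) in *.
    set (s := csum (fun n => deriv_coef b n * z ^ n) M) in *.
    replace (F w - F z - f z * (w - z) - (p - q - s * (w - z)))
      with ((F w - p) + - (F z - q) + - ((f z - s) * (w - z))) by ring.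
    eapply Rle_trans; [apply Cmod_triangle|]. rewrite Cmod_opp, Cmod_mult.
    pose proof (Cmod_triangle (F w - p) (- (F z - q))) as T. rewrite Cmod_opp in T.
    assert (Cmod (f z - s) * Cmod (w - z) <= e * Cmod (w - z))%R by (apply Rmult_le_compat_r; auto).
    replace eps with (e * (2 + Cmod (w - z)))%R by (unfold e; field; lra). lra.
  - intros M _.
    rewrite csum_deriv_coef, <- csum_minus, Cmult_comm, csum_mult, <- csum_minus.
    replace (csum _ (S M) - 0)
        with (csum (fun n => b n * (w ^ n - z ^ n - RtoC (INR n) * z ^ pred n * (w - z))) (S M)).
    2: { unfold Cminus at 4. rewrite Copp_0, Cplus_0_r. apply csum_ext; intros; ring. }
    set (D := (Cmod (w - z) * Cmod (w - z))%R).
    assert (D0 : (0 <= D)%R) by (apply Rmult_le_pos; apply Cmod_ge_0).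
    eapply Rle_trans; [apply Cmod_csum|].
    apply Rle_trans with (rsum (fun n => (A * D) * / 2 ^ n)%R (S M)).
    + apply rsum_le. intros n _. rewrite Cmod_mult.
      eapply Rle_trans; [apply Rmult_le_compat_l; [apply Cmod_ge_0|apply (monomial_taylor rho);
          auto; unfold rho; lra]|].
      fold D. specialize (HA n). rewrite Rpow_mult_distr in HA. pose proof (pow2_pos n).
      apply Rmult_le_reg_r with (2 ^ n)%R; [auto|].
      replace (A * D * / 2 ^ n * 2 ^ n)%R with (D * A)%R by (field; lra).
      replace (Cmod (b n) * (D * (2 * rho)
          ^ n) * 2 ^ n)%R with (D * (Cmod (b n) * (2 ^ n * (2 * rho) ^ n)))%R by ring.
      apply Rmult_le_compat_l; auto.
    + rewrite rsum_mult.
      assert (G : forall m, rsum (fun n => / 2 ^ n)%R m = (2 - 2 / 2 ^ m)%R).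
      { clear. induction m as [|m IH]; [simpl; lra|]. simpl rsum. rewrite IH.
          pose proof (pow2_pos m). simpl. field. lra. }
      rewrite G. assert (0 <= 2 / 2 ^ S M)%R by (apply Rmult_le_pos; [lra|left;
          apply Rinv_0_lt_compat, pow2_pos]).
      assert (0 <= A * D)%R by (apply Rmult_le_pos; auto). nra. }
apply has_deriv_of_eps. intros eps He.
exists (Rmin 1 (eps / (2 * A + 1)))%R. split; [apply Rmin_pos; [lra|apply Rdiv_lt_0_compat; lra]|].
intros w Hw. eapply Rle_trans; [apply Q|].
- pose proof (Cmod_triangle (w - z) z) as T. replace (w - z + z) with w in T by ring.
  pose proof (Rmin_l 1 (eps / (2 * A + 1))). unfold rho; lra.
- rewrite <- Rmult_assoc. apply Rmult_le_compat_r; [apply Cmod_ge_0|].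
  pose proof (Rmin_r 1 (eps / (2 * A + 1))). pose proof (Cmod_ge_0 (w - z)).
  apply Rle_trans with ((2 * A + 1) * (eps / (2 * A + 1)))%R; [|right; field; lra].
  apply Rmult_le_compat; lra.
Qed.

Lemma entire_coef_deriv_coef a : entire_coef a -> entire_coef (deriv_coef a).
Proof.
intros Ha R HR. set (r := (R + 1)%R). destruct (Ha (2 * r)%R) as [A HA]; [unfold r; lra|].
exists A. intros n. eapply Rle_trans; [|apply (HA (S n))].
unfold deriv_coef. rewrite Cmod_mult, Cmod_R, Rabs_pos_eq by apply pos_INR.
pose proof (INR_S_le_pow2 n) as I1.
assert (I2 : (R ^ n <= r ^ S n)%R).
{ apply Rle_trans with (r ^ n)%R; [apply pow_incr; unfold r; lra|]. apply Rle_pow; [unfold r; lra|lia]. }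
rewrite Rpow_mult_distr. rewrite (Rmult_comm (INR (S n))), Rmult_assoc.
apply Rmult_le_compat_l; [apply Cmod_ge_0|]. apply Rmult_le_compat; auto;
    [apply pos_INR|apply pow_le; auto].
Qed.

Lemma expands_deriv F b : expands F b -> exists f, expands f (deriv_coef b) /\ forall z,
    has_deriv F z (f z).
Proof.
intros H. destruct (entire_coef_expands _ (entire_coef_deriv_coef _ (expands_entire_coef _ _ H)))
    as [f Hf].
exists f. split; [auto|]. apply (deriv_expands F f b); auto.
Qed.

Lemma expands_holomorphic f a : expands f a -> holomorphic f.
Proof. intros H z. destruct (expands_deriv f a H) as [g [_ G]]. exists (g z). apply G. Qed.

(** The derivative of an entire function is entire, with no continuity assumed
    beforehand: it is the sum of the differentiated series. *)
Lemma holomorphic_deriv f f' : (forall z, has_deriv f z (f' z)) -> holomorphic f'.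
Proof.
intros H. destruct (holomorphic_expands f) as [a Ha]; [intros z; exists (f' z); apply H|].
destruct (expands_deriv f a Ha) as [g [G1 G2]].
replace f' with g; [exact (expands_holomorphic g _ G1)|].
apply functional_extensionality. intros z. apply (has_deriv_uniq f z); auto.
Qed.

Lemma deriv_expands_deriv_coef f f' a : expands f a -> (forall z,
    has_deriv f z (f' z)) -> expands f' (deriv_coef a).
Proof.
intros Ha H. destruct (expands_deriv f a Ha) as [g [G1 G2]].
replace f' with g; [exact G1|].
apply functional_extensionality. intros z. apply (has_deriv_uniq f z); auto.
Qed.

Definition primitive_coef (a : nat -> C) (n : nat) : C :=
  match n with O => 0 | S m => a m * RtoC (/ INR (S m)) end.

Lemma deriv_coef_primitive_coef a : deriv_coef (primitive_coef a) = a.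
Proof.
apply functional_extensionality. intros n. unfold deriv_coef, primitive_coef.
transitivity (a n * (RtoC (INR (S n)) * RtoC (/ INR (S n)))); [ring|].
rewrite <- RtoC_mult, Rinv_r by (apply not_0_INR; lia). ring.
Qed.

Lemma entire_coef_primitive_coef a : entire_coef a -> entire_coef (primitive_coef a).
Proof.
intros Ha R HR. destruct (Ha R HR) as [A HA].
assert (A0 : (0 <= A)%R).
{ specialize (HA O). pose proof (Cmod_ge_0 (a O)). simpl in HA. lra. }
exists (R * A)%R. intros [|n]; unfold primitive_coef.
- rewrite Cmod_0, Rmult_0_l. apply Rmult_le_pos; auto.
- rewrite Cmod_mult, Cmod_R, Rabs_pos_eq by (left; apply Rinv_0_lt_compat, lt_0_INR; lia).
  change (R ^ S n)%R with (R * R ^ n)%R.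
  replace (Cmod (a n) * / INR (S n)
      * (R * R ^ n))%R with (R * (/ INR (S n) * (Cmod (a n) * R ^ n)))%R by ring.
  apply Rmult_le_compat_l; [auto|]. rewrite <- (Rmult_1_l A).
  apply Rmult_le_compat; auto.
  + left; apply Rinv_0_lt_compat, lt_0_INR; lia.
  + apply Rmult_le_pos; [apply Cmod_ge_0|apply pow_le; auto].
  + rewrite <- Rinv_1. apply Rinv_le_contravar; [lra|]. rewrite S_INR. pose proof (pos_INR n); lra.
Qed.

Lemma expands_0 f a : expands f a -> f 0 = a O.
Proof.
intros H. apply Ceq_minus, Cmod_eq_0. apply Rle_antisym; [|apply Cmod_ge_0].
apply (seq_lim_bound _ _ _ _ 1%nat (expands_seq_lim f a 0 H)). intros M HM.
rewrite (csum_single _ 0%nat M); [|lia|].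
- replace (a O * 0 ^ 0 - a O) with (RtoC 0) by (simpl; ring). rewrite Cmod_0. lra.
- intros n _ Hn. destruct n; [lia|]. simpl. ring.
Qed.

Lemma primitive q : holomorphic q -> exists h : C -> C, h 0 = 0 /\ forall z, has_deriv h z (q z).
Proof.
intros Hq. destruct (holomorphic_expands q Hq) as [a Ha].
destruct (entire_coef_expands _ (entire_coef_primitive_coef _ (expands_entire_coef _ _ Ha))) as [h Hh].
exists h. split; [exact (expands_0 h _ Hh)|].
apply (deriv_expands h q (primitive_coef a)); auto. rewrite deriv_coef_primitive_coef. exact Ha.
Qed.

Lemma expands_eq_const f a : expands f a -> (forall n, a (S n) = 0) -> forall z, f z = f 0.
Proof.
intros H H0 z. rewrite (expands_0 f a H).
apply Ceq_minus, Cmod_eq_0. apply Rle_antisym; [|apply Cmod_ge_0].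
apply (seq_lim_bound _ _ _ _ 1%nat (expands_seq_lim f a z H)). intros M HM.
rewrite (csum_single _ 0%nat M); [|lia|].
- replace (a O * z ^ 0 - a O) with (RtoC 0) by (simpl; ring). rewrite Cmod_0. lra.
- intros n _ Hn. destruct n; [lia|]. rewrite H0. ring.
Qed.

Lemma constant_of_zero_derivative f : (forall z, has_deriv f z 0) -> forall z, f z = f 0.
Proof.
intros H. destruct (holomorphic_expands f) as [a Ha]; [intros z; exists 0; apply H|].
apply (expands_eq_const f a Ha). intros n.
pose proof (deriv_expands_deriv_coef f (fun _ => 0) a Ha H) as E.
assert (Z : expands (fun _ => 0) (fun _ => 0)).
{ intros rho. exists 0%R. intros M z _. rewrite (csum_ext _ (fun _ => 0 * 0)) by (intros; ring).
  rewrite <- csum_mult. match goal with |- (Cmod ?x <= _)%R => replace x with (RtoC 0) by ring end.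
  rewrite Cmod_0. unfold Rdiv; lra. }
pose proof (expands_on_unique _ _ _ 1 ltac:(lra) (E 1%R) (Z 1%R) n) as U. unfold deriv_coef in U.
apply Cmult_cancel_l with (RtoC (INR (S n))); [|rewrite U; ring].
intros B. apply RtoC_inj in B. apply (not_0_INR (S n)); auto.
Qed.

Definition cexp (z : C) : C := ((exp (fst z) * cos (snd z))%R, (exp (fst z) * sin (snd z))%R).

Lemma cexp_plus z w : cexp (z + w) = cexp z * cexp w.
Proof.
unfold cexp. simpl. rewrite exp_plus, cos_plus, sin_plus.
apply injective_projections; simpl; ring.
Qed.

Lemma cexp_0 : cexp 0 = 1.
Proof. unfold cexp; simpl. rewrite exp_0, cos_0, sin_0. apply injective_projections; simpl; ring. Qed.

Lemma Cmod_cexp z : Cmod (cexp z) = exp (Re z).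
Proof.
change (cexp z) with (circle (exp (fst z)) (snd z)). apply Cmod_circle. left; apply exp_pos.
Qed.

Lemma cexp_neq_0 z : cexp z <> 0.
Proof. apply Cmod_gt_0. rewrite Cmod_cexp. apply exp_pos. Qed.

Lemma cexp_opp z : cexp (- z) * cexp z = 1.
Proof. rewrite <- cexp_plus. replace (- z + z) with (RtoC 0) by ring. apply cexp_0. Qed.

Lemma has_deriv_cexp_0 : has_deriv cexp 0 1.
Proof.
apply has_deriv_of_eps. intros eps0 He0. set (eps := (Rmin 1 (eps0 / 10))%R).
assert (He : (0 < eps)%R) by (apply Rmin_pos; lra).
assert (He1 : (eps <= 1)%R) by apply Rmin_l. assert (He2 : (eps <= eps0 / 10)%R) by apply Rmin_r.
assert (D : forall g l, derivable_pt_lim g 0 l -> exists d, (0 < d)%R /\ forall x, (Rabs x < d)%R ->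
    (Rabs (g x - g 0%R - l * x) <= eps * Rabs x)%R).
{ intros g l H. destruct (H eps He) as [d Hd]. exists d. split; [apply cond_pos|].
  intros x Hx. destruct (Req_dec x 0) as [->|N].
  - rewrite Rmult_0_r, !Rminus_diag, Rabs_R0. lra.
  - specialize (Hd x N Hx). rewrite Rplus_0_l in Hd.
    replace (g x - g 0%R - l * x)%R with (((g x - g 0%R) / x - l) * x)%R by (field; auto).
    rewrite Rabs_mult. apply Rmult_le_compat_r; [apply Rabs_pos|lra]. }
destruct (D exp 1%R) as [d1 [P1 H1]]; [pose proof (derivable_pt_lim_exp 0) as Q;
    rewrite exp_0 in Q; exact Q|].
destruct (D cos 0%R) as [d2 [P2 H2]].
{ pose proof (derivable_pt_lim_cos 0) as Q. rewrite sin_0, Ropp_0 in Q. exact Q. }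
destruct (D sin 1%R) as [d3 [P3 H3]]; [pose proof (derivable_pt_lim_sin 0) as Q;
    rewrite cos_0 in Q; exact Q|].
exists (Rmin (Rmin d1 d2) (Rmin d3 (eps / 2))). split; [repeat apply Rmin_pos; lra|].
intros w Hw. replace (w - 0) with w in * by ring.
pose proof (Rle_trans _ _ _ (Rmax_l _ _) (Rmax_Cmod w)) as M1.
pose proof (Rle_trans _ _ _ (Rmax_r _ _) (Rmax_Cmod w)) as M2.
set (x := fst w) in *. set (y := snd w) in *. set (m := Cmod w) in *.
pose proof (Rmin_l (Rmin d1 d2) (Rmin d3 (eps / 2))). pose proof (Rmin_r (Rmin d1 d2)
    (Rmin d3 (eps / 2))).
pose proof (Rmin_l d1 d2). pose proof (Rmin_r d1 d2). pose proof (Rmin_l d3 (eps/2)).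
    pose proof (Rmin_r d3 (eps/2)).
specialize (H1 x ltac:(lra)). specialize (H2 y ltac:(lra)). specialize (H3 y ltac:(lra)).
rewrite exp_0, Rmult_1_l in H1. rewrite cos_0, Rmult_0_l, Rminus_0_r in H2.
rewrite sin_0, Rmult_1_l, Rminus_0_r in H3.
pose proof (Rabs_pos x) as X0. pose proof (Rabs_pos y) as Y0.
assert (E1 : (Rabs (exp x - 1) <= 2 * Rabs x)%R).
{ replace (exp x - 1)%R with ((exp x - 1 - x) + x)%R by ring.
  eapply Rle_trans; [apply Rabs_triang|]. nra. }
assert (E2 : (Rabs (exp x) <= 3)%R).
{ replace (exp x)%R with ((exp x - 1) + 1)%R by ring.
  eapply Rle_trans; [apply Rabs_triang|]. rewrite Rabs_R1. lra. }
eapply Rle_trans; [apply Cmod_le_abs|]. unfold cexp. simpl. fold x y.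
rewrite exp_0, cos_0, sin_0.
replace (exp x * cos y + - (1 * 1)
    + - (1 * x - 0 * y))%R with ((exp x - 1 - x) + exp x * (cos y - 1))%R by ring.
replace (exp x * sin y + - (1 * 0)
    + - (1 * y + 0 * x))%R with (exp x * (sin y - y) + (exp x - 1) * y)%R by ring.
pose proof (Rabs_triang (exp x - 1 - x) (exp x * (cos y - 1))) as T1.
pose proof (Rabs_triang (exp x * (sin y - y)) ((exp x - 1) * y)) as T2.
rewrite Rabs_mult in T1. rewrite !Rabs_mult in T2.
assert (B1 : (Rabs (exp x) * Rabs (cos y - 1) <= 3 * (eps * Rabs y))%R)
    by (apply Rmult_le_compat; auto; apply Rabs_pos).
assert (B2 : (Rabs (exp x) * Rabs (sin y - y) <= 3 * (eps * Rabs y))%R)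
    by (apply Rmult_le_compat; auto; apply Rabs_pos).
assert (B3 : (Rabs (exp x - 1) * Rabs y <= eps * Rabs y)%R) by (apply Rmult_le_compat_r; lra).
assert (B4 : (eps * Rabs x <= eps * m)%R) by (apply Rmult_le_compat_l; lra).
assert (B5 : (eps * Rabs y <= eps * m)%R) by (apply Rmult_le_compat_l; lra).
assert (B6 : (10 * (eps * m) <= eps0 * m)%R) by (assert (0 <= m)%R by apply Cmod_ge_0; nra).
assert (B7 : (0 <= eps * m)%R) by (apply Rmult_le_pos; [lra|apply Cmod_ge_0]).
lra.
Qed.

Lemma has_deriv_cexp z : has_deriv cexp z (cexp z).
Proof.
apply (has_deriv_ext (fun w => cexp z * cexp (w - z))).
{ intros w. rewrite <- cexp_plus. f_equal. ring. }
assert (H : has_deriv (fun w => w + - z) z (1 + 0)).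
{ apply (has_deriv_plus (fun w => w) (fun _ => - z)); [apply has_deriv_id|apply has_deriv_const]. }
assert (H0 : has_deriv cexp (z + - z) 1).
{ replace (z + - z) with (RtoC 0) by ring. apply has_deriv_cexp_0. }
pose proof (has_deriv_scal (cexp z) _ _ _ (has_deriv_comp _ cexp z _ _ H H0)) as H1.
replace (cexp z * (1 * (1 + 0))) with (cexp z) in H1 by ring. exact H1.
Qed.

(** Entire logarithms: [F * exp (- h)] has derivative zero when [h] is a primitive
    of [q]. If [F 0 = 0], this says that [F] vanishes identically, which is the
    uniqueness theorem for the linear equation [F' = q F]. *)
Lemma log_derivative F q : holomorphic q -> (forall z, has_deriv F z (q z * F z)) ->
  exists h : C -> C, h 0 = 0 /\ (forall z, has_deriv h z (q z)) /\ forall z, F z = F 0 * cexp (h z).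
Proof.
intros Hq HF. destruct (primitive q Hq) as [h [h0 Hh]]. exists h. split; [auto|]. split; [auto|].
set (G := fun z => F z * cexp (- h z)).
assert (HG : forall z, G z = G 0).
{ apply constant_of_zero_derivative. intros z.
  replace (RtoC 0) with ((q z * F z) * cexp (- h z) + F z * (cexp (- h z) * (- q z))) by ring.
  apply (has_deriv_mult F (fun w => cexp (- h w))); [apply HF|].
  apply (has_deriv_comp (fun w => - h w) cexp); [apply has_deriv_opp; auto|apply has_deriv_cexp]. }
intros z. transitivity (G z * cexp (h z)).
- unfold G. rewrite <- Cmult_assoc, cexp_opp. ring.
- rewrite HG. unfold G. rewrite h0. replace (- 0) with (RtoC 0) by ring. rewrite cexp_0. ring.
Qed.

(** * Growth estimates from means *)

Definition coef_bounded (a : nat -> C) (r A : R) : Prop := forall n, (Cmod (a n) * r ^ n <= A)%R.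

Lemma coef_bounded_mono a r r' A : (0 <= r <= r')%R -> coef_bounded a r' A -> coef_bounded a r A.
Proof.
intros Hr H n. eapply Rle_trans; [|apply H]. apply Rmult_le_compat_l; [apply Cmod_ge_0|].
apply pow_incr; auto.
Qed.

(** Cauchy's estimate for the derivative, at the price of a factor [1 + del] on
    the radius, from Bernoulli's inequality [n * del <= (1 + del) ^ n]. *)
Lemma coef_bounded_deriv a r del A : (1 <= r)%R -> (0 < del)%R -> (0 <= A)%R ->
  coef_bounded a (r * (1 + del)) A -> coef_bounded (deriv_coef a) r (A / del).
Proof.
intros Hr Hd HA H n. specialize (H (S n)). unfold deriv_coef.
rewrite Cmod_mult, Cmod_R, Rabs_pos_eq by apply pos_INR.
pose proof (poly (S n) del Hd) as B.
assert (B' : (INR (S n) * del <= (1 + del) ^ S n)%R) by lra.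
rewrite Rpow_mult_distr in H.
assert (r0 : (0 < r ^ n)%R) by (apply pow_lt; lra). pose proof (Cmod_ge_0 (a (S n))) as c0.
apply Rmult_le_reg_r with del; [auto|]. unfold Rdiv. rewrite (Rmult_assoc A), Rinv_l, Rmult_1_r by lra.
apply Rle_trans with (Cmod (a (S n)) * (r ^ S n * (1 + del) ^ S n))%R; [|exact H].
replace (INR (S n) * Cmod (a (S n))
    * r ^ n * del)%R with (Cmod (a (S n)) * (r ^ n * (INR (S n) * del)))%R by ring.
apply Rmult_le_compat_l; [auto|]. apply Rmult_le_compat; auto; [lra| |].
- apply Rmult_le_pos; [apply pos_INR|lra].
- simpl. nra.
Qed.

Lemma coef_bounded_eval f a r del A z : expands f a -> (0 <= r)%R -> (0 < del <= 1)%R ->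
  coef_bounded a (r * (1 + del)) A -> (Cmod z <= r)%R -> (Cmod (f z) <= 2 * A / del)%R.
Proof.
intros Hf Hr Hd H Hz.
assert (A0 : (0 <= A)%R).
{ specialize (H O). pose proof (Cmod_ge_0 (a O)). simpl in H. lra. }
replace (f z) with (f z - 0) by ring.
apply (seq_lim_bound _ _ _ _ O (expands_seq_lim f a z Hf)). intros M _.
replace (csum (fun n => a n * z ^ n) M - 0) with (csum (fun n => a n * z ^ n) M) by ring.
eapply Rle_trans; [apply Cmod_csum|].
apply Rle_trans with (rsum (fun n => A * / (1 + del) ^ n)%R M).
- apply rsum_le. intros n _. specialize (H n). rewrite Rpow_mult_distr in H.
  assert (P : (0 < (1 + del) ^ n)%R) by (apply pow_lt; lra).
  apply Rmult_le_reg_r with ((1 + del) ^ n)%R; [auto|]. rewrite (Rmult_assoc A), Rinv_l,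
      Rmult_1_r by lra.
  eapply Rle_trans; [|exact H]. rewrite Cmod_mult, Cmod_pow, Rmult_assoc.
  apply Rmult_le_compat_l; [apply Cmod_ge_0|]. apply Rmult_le_compat_r; [lra|].
  apply pow_incr; split; [apply Cmod_ge_0|auto].
- rewrite rsum_mult.
  assert (G : forall m, rsum (fun n => / (1 + del) ^ n)%R m = ((1 + del) / del * (1 - / (1 + del)
      ^ m))%R).
  { induction m as [|m IH]; [simpl; field; lra|]. simpl rsum. rewrite IH. simpl. field.
    repeat split; try lra; apply pow_nonzero; lra. }
  rewrite G. assert (P : (0 < / (1 + del) ^ M)%R) by (apply Rinv_0_lt_compat, pow_lt; lra).
  apply Rle_trans with (A * ((1 + del) / del * 1))%R.
  + apply Rmult_le_compat_l; [auto|]. apply Rmult_le_compat_l; [|lra].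
    apply Rmult_le_pos; [lra|left; apply Rinv_0_lt_compat; lra].
  + apply Rmult_le_reg_r with del; [lra|].
    replace (A * ((1 + del) / del * 1) * del)%R with (A * (1 + del))%R by (field; lra).
    replace (2 * A / del * del)%R with (2 * A)%R by (field; lra). nra.
Qed.

Lemma Cconj_unity_root N j m : (m <= N)%nat -> (0 < N)%nat -> Cconj ((unity_root N ^ j) ^ m)
    = (unity_root N ^ j) ^ (N - m).
Proof.
intros Hm HN. set (w := unity_root N ^ j).
assert (E : w ^ m * Cconj (w ^ m) = 1).
{ rewrite <- Cmod2_conj, Cmod_pow. unfold w. rewrite Cmod_unity_root_pow, pow1. simpl.
    apply injective_projections; simpl; ring. }
apply Cmult_cancel_l with (w ^ m).
- intros Z. rewrite Z in E. apply C1_nz. rewrite <- E. ring.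
- rewrite E, <- Cpow_add_r. replace (m + (N - m))%nat with N by lia.
  unfold w. rewrite <- Cpow_mult_r, Nat.mul_comm, Cpow_mult_r, unity_root_pow_N,
      Cpow_1_l by auto. reflexivity.
Qed.

Lemma rsum_abs v n : rsum (fun j => Rabs (v j)) n = (2 * rsum (fun j => Rmax 0 (v j)) n - rsum v n)%R.
Proof.
induction n as [|n IH]; simpl; [ring|]. rewrite IH.
unfold Rabs, Rmax. destruct (Rcase_abs (v n)); destruct (Rle_dec 0 (v n)); lra.
Qed.

(** An inequality of Borel and Caratheodory. The Fourier coefficient of index [m]
    of [k] equals that of [2 Re k], because the conjugate of [k] has none of
    positive index. It is therefore at most twice the mean of [|Re k|], and
    [|x| = 2 max (0, x) - x], where the mean of [Re k] tends to [Re (k 0) = 0]. *)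
Lemma borel_caratheodory k b r B : expands k b -> k 0 = 0 ->
  (forall N0, exists N z, (N0 <= N)%nat /\ Cmod z = r /\
     (rsum (fun j => Rmax 0 (Re (k (z * unity_root N ^ j)%C))) N <= INR N * B)%R) ->
  forall m, (0 < m)%nat -> (Cmod (b m) * r ^ m <= 4 * B)%R.
Proof.
intros Hk k0 H m Hm. apply le_epsilon. intros eps0 He0. set (eps := (eps0 / 4)%R).
assert (He : (0 < eps)%R) by (unfold eps; lra).
destruct (coef_mean k b r (Hk r) m eps He) as [N1 [P1 H1]].
destruct (coef_mean k b r (Hk r) 0%nat eps He) as [N2 [P2 H2]].
destruct (H (N1 + N2 + m)%nat) as [N [z [HN [Hz HB]]]].
assert (Hz' : (Cmod z <= r)%R) by lra.
destruct (H1 N z ltac:(lia) Hz') as [E1 E2]. specialize (E2 Hm).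
destruct (H2 N z ltac:(lia) Hz') as [E3 _].
set (u := fun j => k (z * unity_root N ^ j)) in *.
assert (HN0 : (0 < INR N)%R) by (apply lt_0_INR; lia).
(* the mean of [Re u] is close to [Re (k 0) = 0] *)
assert (E4 : (- eps * INR N <= rsum (fun j => Re (u j)) N)%R).
{ rewrite <- (expands_0 k b Hk), k0 in E3.
  rewrite (mean_ext _ _ u) in E3.
  2: { intros j. rewrite Nat.sub_0_r, <- Cpow_mult_r, Nat.mul_comm, Cpow_mult_r,
      unity_root_pow_N, Cpow_1_l by lia. apply Cmult_1_r. }
  replace (mean N u - 0 * z ^ 0) with (mean N u) in E3 by ring.
  pose proof (re_le_Cmod (mean N u)) as Q. unfold mean in Q at 1. rewrite re_scal_l, Re_csum in Q.
  pose proof (Rabs_maj2 (/ INR N * rsum (fun j => Re (u j)) N)) as Q2.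
  assert (Q3 : (- eps <= / INR N * rsum (fun j => Re (u j)) N)%R) by lra.
  apply Rmult_le_compat_r with (r := INR N) in Q3; [|lra].
  replace (/ INR N * rsum (fun j => Re (u j)) N * INR N)%R with (rsum (fun j => Re (u j)) N)
      in Q3 by (field; lra).
  exact Q3. }
assert (E5 : (rsum (fun j => Rabs (Re (u j))) N <= INR N * (2 * B + eps))%R).
{ rewrite rsum_abs. change (rsum (fun j => Rmax 0 (Re (u j))) N <= INR N * B)%R in HB. lra. }
set (v := fun j => (unity_root N ^ j) ^ (N - m)).
assert (E6 : (Cmod (mean N (fun j => RtoC (2 * Re (u j)) * v j)%C) <= 4 * B + 2 * eps)%R).
{ unfold mean. rewrite Cmod_mult, Cmod_R, Rabs_pos_eq by (left; apply Rinv_0_lt_compat; lra).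
  apply Rmult_le_reg_l with (INR N); [auto|]. rewrite <- Rmult_assoc, Rinv_r, Rmult_1_l by lra.
  eapply Rle_trans; [apply Cmod_csum|].
  apply Rle_trans with (rsum (fun j => 2 * Rabs (Re (u j)))%R N).
  - apply rsum_le. intros j _. unfold v. rewrite Cmod_mult, Cmod_R, Cmod_pow,
      Cmod_unity_root_pow, pow1, Rabs_mult, (Rabs_pos_eq 2) by lra. lra.
  - rewrite rsum_mult. lra. }
assert (E7 : (Cmod (mean N (fun j => Cconj (u j) * v j)%C) <= eps)%R).
{ rewrite <- Cmod_conj. unfold mean. rewrite Cmult_conj, csum_conj.
  replace (Cconj (RtoC (/ INR N))) with (RtoC (/ INR N)) by (apply injective_projections; simpl; ring).
  fold (mean N (fun j => Cconj (Cconj (u j) * v j))).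
  rewrite (mean_ext _ _ (fun j => u j * (unity_root N ^ j) ^ m)); [exact E2|].
  intros j. rewrite Cmult_conj, Cconj_conj. unfold v. rewrite <- Cconj_unity_root,
      Cconj_conj by lia. reflexivity. }
assert (E8 : mean N (fun j => RtoC (2 * Re (u j)) * v j)
    = mean N (fun j => u j * v j) + mean N (fun j => Cconj (u j) * v j)).
{ rewrite <- mean_plus. apply mean_ext. intros j. rewrite RtoC_mult, re_alt. field. }
replace (Cmod (b m) * r ^ m)%R with (Cmod (b m * z ^ m)) by (rewrite Cmod_mult, Cmod_pow, Hz;
    reflexivity).
replace (b m * z ^ m)
    with (mean N (fun j => RtoC (2 * Re (u j)) * v j) + - mean N (fun j => Cconj (u j) * v j)
   + - (mean N (fun j => u j * v j) - b m * z ^ m)) by (rewrite E8; ring).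
eapply Rle_trans; [apply Cmod_triangle|]. rewrite Cmod_opp.
pose proof (Cmod_triangle (mean N (fun j => RtoC (2 * Re (u j)) * v j))
    (- mean N (fun j => Cconj (u j) * v j))) as T.
rewrite Cmod_opp in T. fold v in E1. unfold eps in *.
change (Cmod (mean N (fun j => u j * v j) - b m * z ^ m)%C <= eps0 / 4)%R in E1. lra.
Qed.

Fixpoint rprod (u : nat -> R) (n : nat) : R :=
  match n with O => 1%R | S m => (rprod u m * u m)%R end.

Fixpoint cprod (u : nat -> C) (n : nat) : C :=
  match n with O => 1 | S m => cprod u m * u m end.

Lemma Cmod_cprod u n : Cmod (cprod u n) = rprod (fun j => Cmod (u j)) n.
Proof. induction n as [|n IH]; [apply Cmod_1|]. simpl. rewrite Cmod_mult, IH. reflexivity. Qed.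

(** The mean of [log |D|] over the vertices of a regular polygon is the logarithm
    of the modulus of a single entire function, the product of the rotations of
    [D], divided by [N]. So Jensen's inequality becomes the maximum principle for
    that product, and no logarithm of a function with zeros is integrated. The
    factor [1 / 2] leaves room for approximating the value at the center by a
    mean. *)
Lemma rotation_product D N r : holomorphic D -> D 0 <> 0 -> (0 <= r)%R ->
  exists z, Cmod z = r /\ (Cmod (D 0) ^ N / 2 <= rprod (fun j => Cmod (D (z * unity_root N ^ j)%C)) N)%R.
Proof.
intros HD D0 Hr. set (G := fun z => cprod (fun j => D (z * unity_root N ^ j)) N).
assert (HG : holomorphic G).
{ unfold G. generalize N at 2. intros n. induction n as [|n IH]; intros z; [exists 0;
    exact (has_deriv_const 1 z)|].
  destruct (IH z) as [l Hl]. destruct (HD (z * unity_root N ^ n)) as [m Hm].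
  exists (l * D (z * unity_root N ^ n) + cprod (fun j => D (z * unity_root N ^ j))
      n * (m * (1 * unity_root N ^ n + z * 0))).
  apply (has_deriv_mult (fun z => cprod (fun j => D (z * unity_root N ^ j)) n)
      (fun z => D (z * unity_root N ^ n))); [exact Hl|].
  apply (has_deriv_comp (fun z => z * unity_root N ^ n) D); [|exact Hm].
  apply (has_deriv_mult (fun z => z) (fun _ => unity_root N ^ n));
      [apply has_deriv_id|apply has_deriv_const]. }
assert (G0 : Cmod (G 0) = (Cmod (D 0) ^ N)%R).
{ unfold G. rewrite Cmod_cprod. generalize N at 2 3. intros n. induction n as [|n IH]; [reflexivity|].
  simpl. rewrite IH. replace (0 * unity_root N ^ n) with (RtoC 0) by ring. ring. }
assert (P : (0 < Cmod (G 0))%R) by (rewrite G0; apply pow_lt, Cmod_gt_0; auto).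
rewrite <- G0.
destruct (classic (exists z, Cmod z = r /\ (Cmod (G 0) / 2 <= Cmod (G z))%R)) as [[z [Z1 Z2]]|Hn].
{ exists z. split; [auto|]. rewrite <- Cmod_cprod. exact Z2. }
exfalso. destruct (holomorphic_expands G HG) as [g Hg].
destruct (coef_mean G g r (Hg r) 0%nat (Cmod (G 0) / 4)%R ltac:(lra)) as [N1 [P1 H1]].
destruct (H1 N1 (RtoC r) (le_n _)) as [E _]; [rewrite Cmod_R, Rabs_pos_eq; lra|].
rewrite <- (expands_0 G g Hg) in E.
set (x := mean N1 _) in E.
assert (X : (Cmod x <= Cmod (G 0) / 2)%R).
{ apply Cmod_mean; [auto|]. intros j. rewrite Cmod_mult, Cmod_pow, Cmod_unity_root_pow, pow1, Rmult_1_r.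
  apply Rnot_lt_le. intros L. apply Hn. exists (RtoC r * unity_root N1 ^ j). split; [|lra].
  rewrite Cmod_mult, Cmod_unity_root_pow, Cmod_R, Rabs_pos_eq; lra. }
pose proof (Cmod_triangle x (- (x - G 0 * RtoC r ^ 0))) as T. rewrite Cmod_opp in T.
replace (x + - (x - G 0 * RtoC r ^ 0)) with (G 0) in T by (simpl; ring). lra.
Qed.

Lemma rprod_le u v n : (forall j, (0 <= u j <= v j)%R) -> (0 <= rprod u n <= rprod v n)%R.
Proof.
intros H. induction n as [|n IH]; simpl; [lra|]. specialize (H n). split.
- apply Rmult_le_pos; lra.
- apply Rmult_le_compat; lra.
Qed.

Lemma rprod_exp X p n : rprod (fun j => X * exp (- p j))%R n = (X ^ n * exp (- rsum p n))%R.
Proof.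
induction n as [|n IH]; simpl; [rewrite Ropp_0, exp_0; ring|].
rewrite IH, Ropp_plus_distr, exp_plus. ring.
Qed.

(** If [D] is as small as [exp (- Re h)] wherever [Re h] is positive, then
    [log |D|] is below [log X - max (0, Re h)], and its means over suitable
    polygons are at least about [log |D 0|]. *)
Lemma mean_positive_part D h N r X : holomorphic D -> D 0 <> 0 -> (0 <= r)%R -> (0 < N)%nat -> (0
    < X)%R ->
  (forall z, Cmod z = r -> (Cmod (D z) <= X * exp (- Rmax 0 (Re (h z))))%R) ->
  exists z, Cmod z = r /\
   (rsum (fun j => Rmax 0 (Re (h (z * unity_root N ^ j)%C)))
       N <= INR N * (ln X - ln (Cmod (D 0)) + 1))%R.
Proof.
intros HD D0 Hr HN HX H. destruct (rotation_product D N r HD D0 Hr) as [z [Hz HP]].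
exists z. split; [auto|]. set (p := fun j => Rmax 0 (Re (h (z * unity_root N ^ j)))).
assert (Q : (Cmod (D 0) ^ N / 2 <= X ^ N * exp (- rsum p N))%R).
{ rewrite <- rprod_exp. eapply Rle_trans; [exact HP|]. apply rprod_le. intros j. split;
    [apply Cmod_ge_0|].
  apply H. rewrite Cmod_mult, Cmod_unity_root_pow, Hz. ring. }
assert (P : (0 < Cmod (D 0))%R) by (apply Cmod_gt_0; auto).
assert (P1 : (0 < Cmod (D 0) ^ N)%R) by (apply pow_lt; auto).
assert (P2 : (0 < X ^ N)%R) by (apply pow_lt; auto).
assert (L : (ln (Cmod (D 0) ^ N / 2) <= ln (X ^ N * exp (- rsum p N)))%R).
{ destruct Q as [Q|Q]; [left; apply ln_increasing; lra|rewrite Q; lra]. }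
unfold Rdiv in L. rewrite !ln_mult, ln_exp, ln_Rinv, !ln_pow in L by (try lra; try apply exp_pos).
assert (1 <= INR N)%R by (change 1%R with (INR 1); apply le_INR; lia).
assert (ln 2 <= 1)%R by (pose proof ln_lt_2; rewrite <- ln_exp; left; apply ln_increasing;
    [lra|]; pose proof (exp_ineq1 1 ltac:(lra)); lra).
change (rsum p N <= INR N * (ln X - ln (Cmod (D 0)) + 1))%R. nra.
Qed.

(** * An entire function that omits a value while its derivative omits a non-zero value *)

Lemma exp_le a b : (a <= b)%R -> (exp a <= exp b)%R.
Proof. intros [H| ->]; [left; apply exp_increasing; auto|lra]. Qed.

(** The heart of the proof, where [D = h' k' - h'' - h' ^ 2]. If the coefficients of
    [h] are of size [A] on a disc, then [h], [h'], [h''] are of size a power of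
    [1 / del] times [A] on slightly smaller discs. The first identity bounds [Re k]
    from above, hence [k'] in the same way. So [D] is at most a constant times the
    square of a common bound [X] of [h'], [h''] and [k'], and by the second identity
    it is smaller by the factor [exp (- Re h)] where [Re h] is positive.
        The mean of the positive part of [Re h] is then at most
    [2 ln X] up to a constant, and Borel-Caratheodory turns the size [A] of the
    coefficients into a multiple of [ln A]. *)
Lemma coefficient_improvement (h h1 h2 k k1 : C -> C) (a b : nat -> C) (K d w0 : C) :
  expands h a -> h 0 = 0 -> (forall z, has_deriv h z (h1 z)) -> (forall z, has_deriv h1 z (h2 z)) ->
  expands k b -> k 0 = 0 -> (forall z, has_deriv k z (k1 z)) ->
  K <> 0 -> d <> 0 -> w0 <> 0 ->
  (forall z, K * h1 z * cexp (h z) - d = w0 * cexp (k z)) ->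
  (forall z, K * cexp (h z) * (h1 z * k1 z - h2 z - h1 z * h1 z) = d * k1 z) ->
  h1 0 * k1 0 - h2 0 - h1 0 * h1 0 <> 0 ->
  exists C0 : R, (1 <= C0)%R /\ forall r del A : R, (1 <= r)%R -> (0 < del <= 1)%R -> (1 <= A)%R ->
    coef_bounded a (r * (1 + del) ^ 4) A -> coef_bounded a r (C0 * (1 + ln A + ln (/ del))).
Proof.
intros Ha h0 Hh Hh1 Hb k0 Hk K0 d0 w00 E1 E2 D0.
set (D := fun z => h1 z * k1 z - h2 z - h1 z * h1 z) in *.
assert (HD : holomorphic D).
{ assert (H1 : holomorphic h1) by (intros z; exists (h2 z); auto).
  assert (H2 : holomorphic h2) by (apply (holomorphic_deriv h1); auto).
  assert (H3 : holomorphic k1) by (apply (holomorphic_deriv k); auto).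
  intros z. destruct (H1 z) as [l1 L1]. destruct (H2 z) as [l2 L2]. destruct (H3 z) as [l3 L3].
  eexists. apply (has_deriv_plus (fun z => h1 z * k1 z - h2 z) (fun z => - (h1 z * h1 z))).
  - apply (has_deriv_plus (fun z => h1 z * k1 z) (fun z => - h2 z)).
    + apply has_deriv_mult; eauto.
    + apply has_deriv_opp; eauto.
  - apply (has_deriv_opp (fun z => h1 z * h1 z)). apply has_deriv_mult; eauto. }
pose proof (proj1 (Cmod_gt_0 K) K0) as K0'. pose proof (proj1 (Cmod_gt_0 d) d0) as d0'.
pose proof (proj1 (Cmod_gt_0 w0) w00) as w0'.
pose proof (deriv_expands_deriv_coef h h1 a Ha Hh) as Ha1.
pose proof (deriv_expands_deriv_coef h1 h2 _ Ha1 Hh1) as Ha2.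
pose proof (deriv_expands_deriv_coef k k1 b Hb Hk) as Hb1.
set (c1 := Rabs (ln ((Cmod K + Cmod d) / Cmod w0))).
assert (c10 : (0 <= c1)%R) by apply Rabs_pos.
set (c2 := (3 + Cmod d / Cmod K)%R).
assert (c20 : (3 <= c2)%R).
{ unfold c2. assert (0 < Cmod d / Cmod K)%R by (apply Rdiv_lt_0_compat; auto). lra. }
set (c3 := (8 * (c1 + 4))%R).
set (lD := Rabs (ln (Cmod (D 0)))).
assert (lD0 : (0 <= lD)%R) by apply Rabs_pos.
assert (lnpos : forall x, (1 <= x)%R -> (0 <= ln x)%R).
{ intros x Hx. rewrite <- ln_1. destruct Hx as [Hx| <-]; [left; apply ln_increasing; lra|lra]. }
pose proof (lnpos c2 ltac:(lra)) as l2. pose proof (lnpos c3 ltac:(unfold c3; lra)) as l3.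
exists (4 * (ln c2 + 2 * ln c3 + lD + 1) + 32)%R. split; [lra|].
intros r del A Hr Hdel HA Hbd.
assert (Hdi : (1 <= / del)%R) by (rewrite <- Rinv_1; apply Rinv_le_contravar; lra).
set (r1 := (r * (1 + del))%R). set (r2 := (r1 * (1 + del))%R). set (r3 := (r2 * (1 + del))%R).
assert (R1 : (r <= r1)%R) by (unfold r1; nra). assert (R2 : (r1 <= r2)%R) by (unfold r2; nra).
assert (R3 : (r2 <= r3)%R) by (unfold r3; nra).
replace (r * (1 + del) ^ 4)%R with (r3 * (1 + del))%R in Hbd by (unfold r3, r2, r1; ring).
set (i := (/ del)%R) in *.
assert (i0 : (0 < i)%R) by lra.

assert (B0 : forall z, (Cmod z <= r3)%R -> (Cmod (h z) <= 2 * A * i)%R).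
{ intros z Hz. apply (coef_bounded_eval h a r3 del A z); auto; lra. }
pose proof (coef_bounded_deriv a r3 del A ltac:(lra) ltac:(lra) ltac:(lra) Hbd) as Hbd1.
assert (B1 : forall z, (Cmod z <= r2)%R -> (Cmod (h1 z) <= 2 * (A * i) * i)%R).
{ intros z Hz. apply (coef_bounded_eval h1 (deriv_coef a) r2 del (A * i) z); auto; lra. }
assert (Ai : (0 <= A * i)%R) by nra.
pose proof (coef_bounded_deriv _ r2 del _ ltac:(lra) ltac:(lra) Ai Hbd1) as Hbd2.
assert (B2 : forall z, (Cmod z <= r1)%R -> (Cmod (h2 z) <= 2 * (A * i * i) * i)%R).
{ intros z Hz. apply (coef_bounded_eval h2 (deriv_coef (deriv_coef a)) r1 del (A * i * i) z);
    auto; lra. }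
(* the first identity controls only [exp (Re k)], whence Borel-Caratheodory for [k] *)
set (Bk := ((c1 + 4) * (A * i * i))%R).
assert (AI : (1 <= A * i)%R) by nra. assert (AII : (A * i <= A * i * i)%R) by nra.
assert (Bk0 : (0 <= Bk)%R) by (unfold Bk; nra).
assert (RK : forall z, (Cmod z <= r2)%R -> (Re (k z) <= Bk)%R).
{ intros z Hz. specialize (B1 z Hz). assert (Hz3 : (Cmod z <= r3)%R) by lra. specialize (B0 z Hz3).
  pose proof (f_equal Cmod (E1 z)) as M. rewrite (Cmod_mult w0), Cmod_cexp in M.
  pose proof (Cmod_triangle (K * h1 z * cexp (h z)) (- d)) as T. rewrite Cmod_opp, !Cmod_mult,
      Cmod_cexp in T.
  fold (Cminus (K * h1 z * cexp (h z)) d) in T. rewrite M in T.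
  set (x := Cmod (h1 z)) in *. assert (x0 : (0 <= x)%R) by apply Cmod_ge_0.
  set (y := Cmod (h z)) in *. assert (y0 : (0 <= y)%R) by apply Cmod_ge_0.
  assert (Hy : (exp (Re (h z)) <= exp y)%R).
  { apply exp_le. pose proof (re_le_Cmod (h z)). pose proof (Rle_abs (Re (h z))). fold y in H. lra. }
  pose proof (exp_ineq1_le x) as Hx. pose proof (exp_pos (Re (h z))) as p0.
  assert (Hy1 : (1 <= exp y)%R) by (rewrite <- exp_0; apply exp_le; auto).
  assert (Hx1 : (1 <= exp x)%R) by lra.
  assert (U : (exp (Re (k z)) <= (Cmod K + Cmod d) / Cmod w0 * (exp x * exp y))%R).
  { apply Rmult_le_reg_l with (Cmod w0); [auto|].
    replace (Cmod w0 * ((Cmod K + Cmod d)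
        / Cmod w0 * (exp x * exp y)))%R with ((Cmod K + Cmod d) * (exp x * exp y))%R by (field; lra).
    eapply Rle_trans; [exact T|].
    assert (x * exp (Re (h z)) <= exp x * exp y)%R by (apply Rmult_le_compat; lra).
    assert (1 <= exp x * exp y)%R by nra.
    assert (Cmod K * (x * exp (Re (h z)))
        <= Cmod K * (exp x * exp y))%R by (apply Rmult_le_compat_l; lra).
    assert (Cmod d * 1 <= Cmod d * (exp x * exp y))%R by (apply Rmult_le_compat_l; lra).
    lra. }
  rewrite <- (exp_ln ((Cmod K + Cmod d) / Cmod w0)) in U by (apply Rdiv_lt_0_compat; lra).
  rewrite <- !exp_plus in U.
  assert (U' : (Re (k z) <= ln ((Cmod K + Cmod d) / Cmod w0) + (x + y))%R).
  { apply Rnot_lt_le. intros L. apply exp_increasing in L. lra. }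
  pose proof (Rle_abs (ln ((Cmod K + Cmod d) / Cmod w0))) as Q. fold c1 in Q.
  unfold Bk. nra. }
assert (Hbb : coef_bounded b r2 (4 * Bk)).
{ intros n. destruct n as [|n].
  - rewrite <- (expands_0 k b Hb), k0, Cmod_0. lra.
  - apply (borel_caratheodory k b r2 Bk Hb k0); [|lia]. intros N0. exists (S N0), (RtoC r2).
    assert (Cr : Cmod (RtoC r2) = r2) by (rewrite Cmod_R, Rabs_pos_eq; lra).
    split; [lia|]. split; [auto|]. rewrite <- rsum_const. apply rsum_le. intros j _.
    apply Rmax_lub; [auto|]. apply RK. rewrite Cmod_mult, Cmod_unity_root_pow, Cr. lra. }
pose proof (coef_bounded_deriv b r1 del (4 * Bk) ltac:(lra) ltac:(lra) ltac:(lra) Hbb) as Hbb1.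
assert (B3 : forall z, (Cmod z <= r)%R -> (Cmod (k1 z) <= 2 * (4 * Bk * i) * i)%R).
{ intros z Hz. apply (coef_bounded_eval k1 (deriv_coef b) r del (4 * Bk * i) z); auto; lra. }
(* one majorant of [h'], [h''] and [k'] on the smallest disc *)
set (X := (c3 * (A * (i * i * (i * i))))%R).
assert (I2 : (1 <= i * i)%R) by nra.
assert (I3 : (i <= i * i)%R) by nra.
assert (I4 : (i * i <= i * i * (i * i))%R) by nra.
assert (I5 : (i * i * i <= i * i * (i * i))%R) by (rewrite Rmult_assoc;
    rewrite (Rmult_assoc i i (i * i)); apply Rmult_le_compat_l; nra).
assert (A4 : (1 <= A * (i * i * (i * i)))%R) by nra.
assert (X1 : (1 <= X)%R) by (unfold X, c3; nra).
assert (S1 : forall z, (Cmod z <= r)%R -> (Cmod (h1 z) <= X)%R).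
{ intros z Hz. eapply Rle_trans; [apply B1; lra|]. unfold X, c3.
  assert (A * (i * i) <= A * (i * i * (i * i)))%R by (apply Rmult_le_compat_l; lra). nra. }
assert (S2 : forall z, (Cmod z <= r)%R -> (Cmod (h2 z) <= X)%R).
{ intros z Hz. eapply Rle_trans; [apply B2; lra|]. unfold X, c3.
  assert (A * (i * i * i) <= A * (i * i * (i * i)))%R by (apply Rmult_le_compat_l; lra). nra. }
assert (S3 : forall z, (Cmod z <= r)%R -> (Cmod (k1 z) <= X)%R).
{ intros z Hz. eapply Rle_trans; [apply B3; lra|]. unfold X, c3, Bk. right; ring. }
set (Y := (c2 * (X * X))%R).
assert (Y0 : (0 < Y)%R) by (unfold Y; nra).
assert (SD : forall z, Cmod z = r -> (Cmod (D z) <= Y * exp (- Rmax 0 (Re (h z))))%R).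
{ intros z Hz. assert (Hz' : (Cmod z <= r)%R) by lra.
  specialize (S1 z Hz'). specialize (S2 z Hz'). specialize (S3 z Hz').
  pose proof (Cmod_ge_0 (h1 z)). pose proof (Cmod_ge_0 (h2 z)). pose proof (Cmod_ge_0 (k1 z)).
  assert (XX : (X <= X * X)%R) by nra.
  assert (dK : (0 < Cmod d / Cmod K)%R) by (apply Rdiv_lt_0_compat; auto).
  unfold Rmax. destruct (Rle_dec 0 (Re (h z))) as [L|L].
  - (* the identity makes D as small as exp (- Re h) *)
    pose proof (f_equal Cmod (E2 z)) as M. fold (D z) in M. rewrite !Cmod_mult, Cmod_cexp in M.
    replace (Cmod (D z)) with (Cmod d / Cmod K * Cmod (k1 z) * exp (- Re (h z)))%R.
    + apply Rmult_le_compat_r; [left; apply exp_pos|]. unfold Y, c2.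
      assert (Cmod d / Cmod K * Cmod (k1 z)
          <= Cmod d / Cmod K * (X * X))%R by (apply Rmult_le_compat_l; lra).
      nra.
    + apply Rmult_eq_reg_l with (Cmod K * exp (Re (h z)))%R.
      * rewrite M, exp_Ropp. pose proof (exp_pos (Re (h z))). field; split; lra.
      * apply Rmult_integral_contrapositive. split; [lra|apply Rgt_not_eq, exp_pos].
  - rewrite Ropp_0, exp_0, Rmult_1_r. unfold D, Cminus.
    pose proof (Cmod_triangle (h1 z * k1 z + - h2 z) (- (h1 z * h1 z))) as T1.
    pose proof (Cmod_triangle (h1 z * k1 z) (- h2 z)) as T2.
    rewrite Cmod_opp, Cmod_mult in T1. rewrite Cmod_opp, Cmod_mult in T2.
    assert (Cmod (h1 z) * Cmod (k1 z) <= X * X)%R by (apply Rmult_le_compat; auto).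
    assert (Cmod (h1 z) * Cmod (h1 z) <= X * X)%R by (apply Rmult_le_compat; auto).
    unfold Y, c2. nra. }
assert (r0 : (0 <= r)%R) by lra.
set (B := (ln Y - ln (Cmod (D 0)) + 1)%R).
assert (LB : (4 * B <= (4 * (ln c2 + 2 * ln c3 + lD + 1) + 32) * (1 + ln A + ln i))%R).
{ assert (c3p : (0 < c3)%R) by (unfold c3; lra).
  assert (iip : (0 < i * i)%R) by lra. assert (i4p : (0 < i * i * (i * i))%R) by lra.
  assert (XXp : (0 < X * X)%R) by nra.
  assert (lX : (ln X = ln c3 + (ln A + 4 * ln i))%R).
  { unfold X. rewrite ln_mult, (ln_mult A), (ln_mult (i * i)), (ln_mult i) by lra. ring. }
  unfold B, Y. rewrite ln_mult, (ln_mult X), lX by lra.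
  pose proof (lnpos A HA) as la. pose proof (lnpos i Hdi) as li.
  pose proof (Rle_abs (- ln (Cmod (D 0)))) as Q. rewrite Rabs_Ropp in Q. fold lD in Q.
  nra. }
assert (HB : (0 <= B)%R).
{ destruct (mean_positive_part D h 1 r Y HD D0 r0 ltac:(lia) Y0 SD) as [z [_ Hz]].
  simpl in Hz. pose proof (Rmax_l 0 (Re (h (z * 1)))). unfold B. lra. }
intros n. eapply Rle_trans; [|exact LB]. destruct n as [|n].
- rewrite <- (expands_0 h a Ha), h0, Cmod_0. lra.
- apply (borel_caratheodory h a r B Ha h0); [|lia]. intros N0.
  destruct (mean_positive_part D h (S N0) r Y HD D0 r0 ltac:(lia) Y0 SD) as [z [Hz1 Hz2]].
  exists (S N0), z. split; [lia|]. split; auto.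
Qed.

(** Borel's growth lemma in a discrete form. On the radii
    [R n = r * (2 - 1 / 2 ^ n)], consecutive ratios allow [del] of order [1 / 2 ^ n],
    so a bound [A] on the circle [n + 1] becomes [C0 * (n + 7 + ln A)] on the circle
    [n]. Bounds of the form [L * (n + 1)] are preserved by this step when [L] is a
    large multiple of [C0 ^ 2]. Any bound on the disc of radius [2 * r] is of that
    form for some large [n]; descending to [n = 0] leaves [L], which does not
    depend on [r]. *)
Lemma growth_lemma a C0 : entire_coef a -> (1 <= C0)%R ->
  (forall r del A : R, (1 <= r)%R -> (0 < del <= 1)%R -> (1 <= A)%R ->
    coef_bounded a (r * (1 + del) ^ 4) A -> coef_bounded a r (C0 * (1 + ln A + ln (/ del)))) ->
  exists L, forall r, (1 <= r)%R -> coef_bounded a r L.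
Proof.
intros Ha HC H. set (L := (100 * (C0 * C0))%R). exists L. intros r Hr.
assert (L1 : (1 <= L)%R) by (unfold L; nra).
assert (ln2 : (ln 2 <= 1)%R).
{ rewrite <- (ln_exp 1). left; apply ln_increasing; [lra|]. pose proof (exp_ineq1 1 ltac:(lra)); lra. }
assert (lnx : forall x, (0 < x)%R -> (ln x <= x - 1)%R).
{ intros x Hx. pose proof (exp_ineq1_le (ln x)) as E. rewrite exp_ln in E by auto. lra. }
assert (lnL : (ln L <= 20 * C0)%R).
{ unfold L. replace (100 * (C0 * C0))%R with ((10 * C0) * (10 * C0))%R by ring.
  rewrite ln_mult by lra. pose proof (lnx (10 * C0)%R ltac:(lra)). lra. }
set (R := fun n => (r * (2 - / 2 ^ n))%R).
assert (Step : forall n A, (1 <= A)%R -> coef_bounded a (R (S n)) A -> coef_bounded a (R n)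
    (C0 * (1 + ln A + (INR n + 6)))%R).
{ intros n A HA HB. set (t := (/ 2 ^ n)%R).
  assert (t0 : (0 < t <= 1)%R).
  { split; [apply Rinv_0_lt_compat, pow2_pos|]. unfold t. rewrite <- Rinv_1.
    apply Rinv_le_contravar; [lra|]. apply pow_R1_Rle; lra. }
  (* [(1 + del) ^ 4 <= 1 + 15 * del], and [R (S n) / R n >= 1 + t / 4] *)
  set (del := (t / 64)%R).
  assert (Rn : (1 <= R n)%R) by (unfold R; fold t; nra).
  assert (HB' : coef_bounded a (R n * (1 + del) ^ 4) A).
  { apply (coef_bounded_mono a _ (R (S n))); [|auto]. assert (0 < (1 + del)
      ^ 4)%R by (apply pow_lt; unfold del; lra). split; [nra|].
    unfold R. simpl (2 ^ S n)%R. rewrite Rinv_mult. fold t.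
    assert (P : ((1 + del) ^ 4 <= 1 + 15 * del)%R).
    { assert (0 < del <= 1)%R by (unfold del; lra).
      assert (del * del <= del)%R by nra. assert (del * del * del <= del)%R by nra.
      assert (del * del * del * del <= del)%R by nra.
      replace ((1 + del) ^ 4)%R with (1 + 4 * del + 6 * (del * del)
          + 4 * (del * del * del) + del * del * del * del)%R by ring. lra. }
    rewrite Rmult_assoc. apply Rmult_le_compat_l; [lra|].
    apply Rle_trans with ((2 - t) * (1 + 15 * del))%R; [apply Rmult_le_compat_l; lra|].
        unfold del. nra. }
  pose proof (H (R n) del A Rn ltac:(unfold del; lra) HA HB') as Q.
  intros m. eapply Rle_trans; [apply Q|]. apply Rmult_le_compat_l; [lra|]. apply Rplus_le_compat_l.
  unfold del, t. replace (/ (/ 2 ^ n / 64))%R with (2 ^ (n + 6))%R.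
  - rewrite ln_pow by lra. rewrite plus_INR. simpl (INR 6). pose proof (pos_INR n). nra.
  - rewrite pow_add. pose proof (pow2_pos n). field; lra. }
assert (Down : forall N n, (n <= N)%nat -> coef_bounded a (R N)
    (L * (INR N + 1)) -> coef_bounded a (R (N - n)%nat) (L * (INR (N - n) + 1))).
{ intros N n Hn HN. induction n as [|n IH]; [rewrite Nat.sub_0_r; auto|].
  specialize (IH ltac:(lia)). set (m := (N - S n)%nat). replace (N - n)%nat with (S m)
      in IH by (unfold m; lia).
  pose proof (pos_INR m) as m0. rewrite S_INR in IH.
  assert (HA : (1 <= L * (INR m + 1 + 1))%R) by nra.
  pose proof (Step m _ HA IH) as Q. intros j. eapply Rle_trans; [apply Q|].
  rewrite ln_mult by lra. pose proof (lnx (INR m + 1 + 1)%R ltac:(lra)) as E.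
  apply Rle_trans with (C0 * (8 + 20 * C0 + 2 * INR m))%R; [apply Rmult_le_compat_l; lra|].
  assert (C2 : (C0 <= C0 * C0)%R) by nra.
  assert (C3 : (C0 * INR m <= C0 * C0 * INR m)%R) by (apply Rmult_le_compat_r; auto).
  assert (C4 : (0 <= C0 * C0 * INR m)%R) by (apply Rmult_le_pos; [lra|auto]).
  unfold L. lra. }
destruct (Ha (2 * r)%R ltac:(lra)) as [M0 HM0].
destruct (INR_unbounded M0) as [N HN].
assert (HRN : (0 <= R N <= 2 * r)%R).
{ unfold R. assert (0 < / 2 ^ N <= 1)%R.
  { split; [apply Rinv_0_lt_compat, pow2_pos|]. rewrite <- Rinv_1.
    apply Rinv_le_contravar; [lra|]. apply pow_R1_Rle; lra. }
  nra. }
assert (HB : coef_bounded a (R N) (L * (INR N + 1))).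
{ intros n. eapply Rle_trans; [apply (coef_bounded_mono a (R N) (2 * r) M0 HRN HM0)|].
    pose proof (pos_INR N). nra. }
pose proof (Down N N (le_n _) HB) as Q. rewrite Nat.sub_diag in Q. simpl INR in Q.
unfold R in Q. simpl in Q. rewrite Rinv_1 in Q.
replace (r * (2 - 1))%R with r in Q by ring. replace (L * (0 + 1))%R with L in Q by ring. exact Q.
Qed.

Lemma bounded_coefficients_vanish a L : (forall r, (1 <= r)%R -> coef_bounded a r L) -> forall n,
    a (S n) = 0.
Proof.
intros H n. apply Cmod_eq_0. apply Rle_antisym; [|apply Cmod_ge_0].
apply le_epsilon. intros eps He. rewrite Rplus_0_l.
assert (L0 : (0 <= L)%R).
{ pose proof (H 1%R ltac:(lra) O) as Q. pose proof (Cmod_ge_0 (a O)). simpl in Q. lra. }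
set (r := (1 + L / eps)%R).
assert (q0 : (0 <= L / eps)%R) by (apply Rmult_le_pos; [auto|left; apply Rinv_0_lt_compat; auto]).
assert (Hr : (1 <= r)%R) by (unfold r; lra).
pose proof (H r Hr (S n)) as Q. pose proof (Cmod_ge_0 (a (S n))) as c0.
assert (P : (r <= r ^ S n)%R).
{ rewrite <- (pow_1 r) at 1. apply Rle_pow; [auto|lia]. }
assert (Q' : (Cmod (a (S n)) * r <= L)%R) by nra.
apply Rmult_le_reg_r with r; [lra|]. eapply Rle_trans; [exact Q'|]. unfold r.
replace (eps * (1 + L / eps))%R with (eps + L)%R by (field; lra). lra.
Qed.

(** With [f - c = K exp h] and [f' - d = w0 exp k] one finds
    [D = d * f'' / ((f - c) * (f' - d))], so [D 0] is nonzero as soon as [f'' 0] is. *)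
Lemma omitted_values_at_0 (f f1 f2 : C -> C) (c d : C) : d <> 0 ->
  (forall z, has_deriv f z (f1 z)) -> (forall z, has_deriv f1 z (f2 z)) ->
  (forall z, f z <> c) -> (forall z, f1 z <> d) -> f2 0 = 0.
Proof.
intros Hd Hf Hf1 Nc Nd.
destruct (Ceq_dec (f2 0) 0) as [E|N2]; [exact E|exfalso].
set (F := fun z => f z - c). set (w := fun z => f1 z - d).
assert (NF : forall z, F z <> 0) by (intros z; apply Cminus_eq_contra; auto).
assert (Nw : forall z, w z <> 0) by (intros z; apply Cminus_eq_contra; auto).
assert (DF : forall z, has_deriv F z (f1 z)).
{ intros z. replace (f1 z) with (f1 z + 0) by ring. apply (has_deriv_plus f (fun _ => - c));
    [auto|apply has_deriv_const]. }
assert (Dw : forall z, has_deriv w z (f2 z)).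
{ intros z. replace (f2 z) with (f2 z + 0) by ring. apply (has_deriv_plus f1 (fun _ => - d));
    [auto|apply has_deriv_const]. }
set (q := fun z => f1 z * / F z). set (q1 := fun z => f2 z * / F z + f1 z * (- f1 z / (F z * F z))).
assert (Dq : forall z, has_deriv q z (q1 z)).
{ intros z. apply (has_deriv_mult f1 (fun z => / F z)); [auto|]. apply has_deriv_inv; auto. }
assert (Hf2 : holomorphic f2) by (apply (holomorphic_deriv f1); auto).
set (k1 := fun z => f2 z * / w z).
assert (Hk1 : holomorphic k1).
{ intros z. destruct (Hf2 z) as [l Hl]. eexists. apply (has_deriv_mult f2 (fun z => / w z)); [exact Hl|].
  apply has_deriv_inv; auto. }
destruct (log_derivative F q) as [h [h0 [Hh EF]]].
{ intros z; exists (q1 z); auto. }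
{ intros z. replace (q z * F z) with (f1 z); [auto|]. unfold q. field. auto. }
destruct (log_derivative w k1 Hk1) as [k [k0 [Hk Ew]]].
{ intros z. replace (k1 z * w z) with (f2 z); [auto|]. unfold k1. field. auto. }
destruct (holomorphic_expands h) as [a Ha]; [intros z; exists (q z); auto|].
destruct (holomorphic_expands k) as [b Hb]; [intros z; exists (k1 z); auto|].
assert (ED : forall z, q z * k1 z - q1 z - q z * q z = f2 z * d / (F z * w z)).
{ intros z. replace d with (f1 z - w z) by (unfold w; ring). unfold q, k1, q1. field. auto. }
destruct (coefficient_improvement h q q1 k k1 a b (F 0) d (w 0)) as [C0 [HC HI]]; auto.
- intros z. rewrite <- Ew. rewrite <- Cmult_assoc, (Cmult_comm (q z)), Cmult_assoc, <- EF.
  unfold q, w. field. auto.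
- intros z. rewrite <- EF, ED. unfold k1. field. auto.
- rewrite ED. unfold Cdiv. apply Cmult_neq_0; [apply Cmult_neq_0; auto|].
  intros Z. assert (E : F 0 * w 0 <> 0) by (apply Cmult_neq_0; auto).
  apply C1_nz. rewrite <- (Cinv_r (F 0 * w 0)) by auto. rewrite Z. ring.
- destruct (growth_lemma a C0 (expands_entire_coef h a Ha) HC HI) as [L HL].
  pose proof (expands_eq_const h a Ha (bounded_coefficients_vanish a L HL)) as Hc.
  assert (q0 : forall z, q z = 0).
  { intros z. apply (has_deriv_uniq h z); [auto|].
    apply (has_deriv_ext (fun _ => h 0)); [intros; symmetry; apply Hc|apply has_deriv_const]. }
  assert (f10 : forall z, f1 z = 0).
  { intros z. transitivity (q z * F z); [unfold q; field; auto|rewrite q0; ring]. }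
  apply N2. apply (has_deriv_uniq f1 0); [auto|].
  apply (has_deriv_ext (fun _ => 0)); [intros; symmetry; apply f10|apply has_deriv_const].
Qed.

(** The special point of the previous lemma can be any point, by translation. So
    [f''] vanishes identically, [f] is affine, and a nonconstant affine function
    takes the value [c]. *)
Theorem omitted_values (f f1 : C -> C) (c d : C) : d <> 0 -> (forall z, has_deriv f z (f1 z)) ->
  (forall z, f z <> c) -> (forall z, f1 z <> d) -> forall z, f z = f 0.
Proof.
intros Hd Hf Nc Nd.
pose proof (holomorphic_deriv f f1 Hf) as H1.
destruct (holomorphic_expands f1 H1) as [a1 Ha1]. destruct (expands_deriv f1 a1 Ha1) as [f2 [_ Hf2]].
assert (Z2 : forall p, f2 p = 0).
{ intros p. pose proof (omitted_values_at_0 (fun z => f (z + p)) (fun z => f1 (z + p))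
    (fun z => f2 (z + p)) c d Hd) as Q.
  assert (Sh : forall g g1 : C -> C, (forall z, has_deriv g z (g1 z)) -> forall z,
      has_deriv (fun z => g (z + p)) z (g1 (z + p))).
  { intros g g1 Hg z. replace (g1 (z + p)) with (g1 (z + p) * (1 + 0)) by ring.
    apply (has_deriv_comp (fun z => z + p) g); [|auto]. apply (has_deriv_plus (fun z => z)
        (fun _ => p)); [apply has_deriv_id|apply has_deriv_const]. }
  specialize (Q (Sh f f1 Hf) (Sh f1 f2 Hf2) (fun z => Nc (z + p)) (fun z => Nd (z + p))). cbv beta in Q.
  rewrite Cplus_0_l in Q. exact Q. }
assert (K1 : forall z, f1 z = f1 0).
{ apply constant_of_zero_derivative. intros z. rewrite <- (Z2 z). auto. }
set (al := f1 0) in *.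
assert (Lin : forall z, f z - al * z = f 0 - al * 0).
{ apply (constant_of_zero_derivative (fun z => f z - al * z)). intros z.
  replace (RtoC 0) with (f1 z + - (al * 1)) by (rewrite K1; ring).
  apply (has_deriv_plus f (fun z => - (al * z))); [auto|]. apply has_deriv_opp.
      apply has_deriv_scal. apply has_deriv_id. }
destruct (Ceq_dec al 0) as [E|N].
- intros z. specialize (Lin z). rewrite E in Lin.
  transitivity (f z - 0 * z); [ring|rewrite Lin; ring].
- exfalso. apply (Nc ((c - f 0) / al)). specialize (Lin ((c - f 0) / al)).
  transitivity (f ((c - f 0) / al) - al * ((c - f 0) / al) + al * ((c - f 0) / al)); [ring|].
  rewrite Lin. field. auto.
Qed.

(** * The differential equation *)

Lemma entire_has_deriv f : entire f -> forall z, has_deriv f z (C_derive f z).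
Proof. intros Hf z. apply is_derive_has_deriv. apply C_derive_correct; [exact z|apply Hf]. Qed.

Lemma entire2_comp g u v : entire2 g -> holomorphic u -> holomorphic v -> holomorphic (fun z => g
    (u z, v z)).
Proof.
intros Hg Hu Hv z. destruct (Hu z) as [l Hl]. destruct (Hv z) as [m Hm].
destruct (Hg (u z, v z)) as [L [HL Hdom]].
specialize (Hdom (u z, v z) (fun P HP => HP)).
set (L1 := L (RtoC 1, RtoC 0)). set (L2 := L (RtoC 0, RtoC 1)).
assert (EL : forall x y : C, L (x, y) = x * L1 + y * L2 :> C).
{ intros x y. unfold L1, L2.
  change (L (x, y) = plus (scal x (L (RtoC 1, RtoC 0))) (scal y (L (RtoC 0, RtoC 1))) :> C).
  rewrite <- !(linear_scal L HL), <- (linear_plus L HL). f_equal.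
  apply injective_projections.
  - change (x = x * 1 + y * 0 :> C). ring.
  - change (y = x * 0 + y * 1 :> C). ring. }
exists (l * L1 + m * L2).
apply has_deriv_of_eps. intros eps He.
set (S := (2 * (Cmod l + 1 + (Cmod m + 1)) + Cmod L1 + Cmod L2 + 1)%R).
pose proof (Cmod_ge_0 l) as l0. pose proof (Cmod_ge_0 m) as m0.
pose proof (Cmod_ge_0 L1) as L10. pose proof (Cmod_ge_0 L2) as L20.
assert (S0 : (0 < S)%R) by (unfold S; lra).
set (e := Rmin 1 (eps / S)).
assert (e0 : (0 < e)%R) by (apply Rmin_pos; [lra|apply Rdiv_lt_0_compat; lra]).
assert (e1 : (e <= 1)%R) by apply Rmin_l.
assert (eS : (e * S <= eps)%R).
{ apply Rle_trans with (eps / S * S)%R; [apply Rmult_le_compat_r; [lra|apply Rmin_r]|right;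
    field; lra]. }
destruct (Hdom (mkposreal e e0)) as [d Hd]. simpl pos in Hd.
pose proof (cond_pos d) as d0.
destruct (has_deriv_eps _ _ _ Hl e e0) as [d1 [P1 H1]]. destruct (has_deriv_eps _ _ _ Hm e e0)
    as [d2 [P2 H2]].
set (T := (Cmod l + 1 + (Cmod m + 1))%R). assert (T0 : (0 < T)%R) by (unfold T; lra).
exists (Rmin (Rmin d1 d2) (d / T)). split; [repeat apply Rmin_pos; try lra;
    apply Rdiv_lt_0_compat; lra|].
intros w Hw.
pose proof (Rmin_l (Rmin d1 d2) (d / T)). pose proof (Rmin_r (Rmin d1 d2) (d / T)).
pose proof (Rmin_l d1 d2). pose proof (Rmin_r d1 d2).
specialize (H1 w ltac:(lra)). specialize (H2 w ltac:(lra)).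
set (n := Cmod (w - z)) in *. assert (n0 : (0 <= n)%R) by apply Cmod_ge_0.
set (du := u w - u z) in *. set (dv := v w - v z) in *.
assert (U : (Cmod du <= (Cmod l + 1) * n)%R).
{ replace du with ((du - l * (w - z)) + l * (w - z)) by ring.
  eapply Rle_trans; [apply Cmod_triangle|]. rewrite Cmod_mult. fold n. nra. }
assert (V : (Cmod dv <= (Cmod m + 1) * n)%R).
{ replace dv with ((dv - m * (w - z)) + m * (w - z)) by ring.
  eapply Rle_trans; [apply Cmod_triangle|]. rewrite Cmod_mult. fold n. nra. }
assert (Tn : (T * n < d)%R).
{ apply Rlt_le_trans with (T * (d / T))%R; [apply Rmult_lt_compat_l; lra|right; field; lra]. }
assert (UT : (Cmod du <= T * n)%R) by (unfold T; nra). assert (VT : (Cmod dv <= T * n)%R)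
    by (unfold T; nra).
assert (Hb : forall x y : C, (Cmod (y - x) < d)%R -> @ball C_UniformSpace x d y).
{ intros x y Hxy. pose proof (Rmax_Cmod (y - x)) as M. split.
  - eapply Rle_lt_trans; [exact (Rle_trans _ _ _ (Rmax_l _ _) M)|exact Hxy].
  - eapply Rle_lt_trans; [exact (Rle_trans _ _ _ (Rmax_r _ _) M)|exact Hxy]. }
specialize (Hd (u w, v w) (conj (Hb (u z) (u w) (Rle_lt_trans _ _ _ UT Tn)) (Hb (v z) (v w)
    (Rle_lt_trans _ _ _ VT Tn)))).
change (Cmod (g (u w, v w) - g (u z, v z) - L (du, dv))
  <= e * @norm C_AbsRing (prod_NormedModule C_AbsRing C_NormedModule C_NormedModule) (du, dv))%R in Hd.
pose proof (proj2 (norm_prod (K := C_AbsRing) (U := C_NormedModule) (V := C_NormedModule) du dv)) as N.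
change (@norm C_AbsRing C_NormedModule du) with (Cmod du) in N.
change (@norm C_AbsRing C_NormedModule dv) with (Cmod dv) in N.
set (nn := @norm C_AbsRing (prod_NormedModule C_AbsRing C_NormedModule C_NormedModule) (du, dv)) in *.
assert (S2 : (sqrt 2 <= 2)%R).
{ rewrite <- (sqrt_square 2) at 2 by lra. apply sqrt_le_1_alt. lra. }
assert (NN : (nn <= 2 * (T * n))%R).
{ eapply Rle_trans; [exact N|]. apply Rmult_le_compat; [apply sqrt_pos| |auto|apply Rmax_lub; auto].
  eapply Rle_trans; [apply Cmod_ge_0|apply Rmax_l]. }
rewrite EL in Hd.
replace (g (u w, v w) - g (u z, v z) - (l * L1 + m * L2) * (w - z))
  with ((g (u w, v w) - g (u z, v z) - (du * L1 + dv * L2))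
    + ((du - l * (w - z)) * L1 + (dv - m * (w - z)) * L2)) by ring.
eapply Rle_trans; [apply Cmod_triangle|].
pose proof (Cmod_triangle ((du - l * (w - z)) * L1) ((dv - m * (w - z)) * L2)) as Q.
rewrite !Cmod_mult in Q.
assert (Q1 : (Cmod (du - l * (w - z)) * Cmod L1 <= e * n * Cmod L1)%R)
    by (apply Rmult_le_compat_r; auto).
assert (Q2 : (Cmod (dv - m * (w - z)) * Cmod L2 <= e * n * Cmod L2)%R)
    by (apply Rmult_le_compat_r; auto).
assert (Q3 : (e * nn <= e * (2 * (T * n)))%R) by (apply Rmult_le_compat_l; lra).
assert (Q4 : (e * S * n <= eps * n)%R) by (apply Rmult_le_compat_r; auto).
assert (Q5 : (0 <= e * n)%R) by (apply Rmult_le_pos; lra).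
unfold S in Q4. fold T in Q4. nra.
Qed.

Theorem theorem1 :
  forall (c d : C) (a : C -> C) (P : C * C -> C),
    d <> 0 ->
    entire a ->
    entire2 P ->
    entire2_divides (fun p : C * C => (fst p - c) * (snd p - d)) P ->
    forall f : C -> C,
      entire f ->
      (forall z : C, C_derive f z + a z * P (f z, C_derive f z) = 0) ->
      exists w : C, forall z : C, f z = w.
Proof.
intros c d a P Hd Ha _ [g [Hg HP]] f Hf Heq.
set (f1 := C_derive f) in *.
assert (Df : forall z, has_deriv f z (f1 z)) by (intros; apply entire_has_deriv; auto).
assert (H1 : holomorphic f1) by (apply (holomorphic_deriv f); auto).
assert (H0 : holomorphic f) by (intros z; exists (f1 z); auto).
assert (Eq : forall z, f1 z = - (a z * ((f z - c) * (f1 z - d) * g (f z, f1 z)))).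
{ intros z. specialize (Heq z). rewrite HP in Heq. simpl in Heq.
  apply (f_equal (fun x => x - a z * ((f z - c) * (f1 z - d) * g (f z, f1 z)))) in Heq.
  transitivity (0 - a z * ((f z - c) * (f1 z - d) * g (f z, f1 z))); [rewrite <- Heq|]; ring. }
(* where [f' = d] the equation reads [f' = 0] *)
assert (Nd : forall z, f1 z <> d).
{ intros z E. apply Hd. rewrite <- E, Eq, E. ring. }
set (q := fun z => - (a z * ((f1 z - d) * g (f z, f1 z)))).
assert (Hq : holomorphic q).
{ intros z. destruct (entire2_comp g f f1 Hg H0 H1 z) as [l Hl]. destruct (H1 z) as [m Hm].
  eexists. apply (has_deriv_opp (fun z => a z * ((f1 z - d) * g (f z, f1 z)))).
  apply (has_deriv_mult a (fun z => (f1 z - d) * g (f z, f1 z))); [apply entire_has_deriv; auto|].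
  apply (has_deriv_mult (fun z => f1 z - d) (fun z => g (f z, f1 z))); [|exact Hl].
  apply (has_deriv_plus f1 (fun _ => - d)); [exact Hm|apply has_deriv_const]. }
destruct (log_derivative (fun z => f z - c) q Hq) as [h [_ [_ E]]].
{ intros z. replace (q z * (f z - c)) with (f1 z + 0) by (rewrite Eq; unfold q; ring).
  apply (has_deriv_plus f (fun _ => - c)); [auto|apply has_deriv_const]. }
destruct (Ceq_dec (f 0) c) as [F0|F0].
- exists c. intros z. apply Ceq_minus. rewrite E, F0. ring.
- exists (f 0). apply (omitted_values f f1 c d Hd Df); auto.
  intros z Z. assert (Q : f z - c <> 0).
  { rewrite E. apply Cmult_neq_0; [apply Cminus_eq_contra; auto|apply cexp_neq_0]. }
  apply Q. rewrite Z. ring.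
Qed.
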